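(* Let $F$ be a non-archimedean local field of arbitrary characteristic, $G=SL(2)$, $f\in\mathcal C_c^\infty(G(F))$, $z\in Z(F)$ where $Z$ is the center of $G$, and let $T\subset G$ be a maximal torus defined over $F$. For each elliptic datum $\mathcal E=\{H,\kappa\}$ such that $T$ embeds in $H$, fix an embedding $\iota:T\to H$ and an endoscopic transfer $f^{\mathcal E}\in\mathcal C_c^\infty(H(F))$ of $f$, and define, for $t\in T(F)$ regular, $$\Phi^{\mathcal E}(t)=\begin{cases}\Delta^{\mathcal E}(t)^{-1}\,\mathcal{SO}_H(\iota(t),f^{\mathcal E})&\text{if there is an embedding of } T \text{ in } H,\\ 0&\text{otherwise.}\end{cases}$$ Then there is a neighbourhood of $z$ in $T(F)$ such that for every regular $t\in T(F)$ in this neighbourhood the following hold. (1) The orbital integral is a sum over elliptic endoscopic data: $$\mathcal O_G(t,f)=\sum_{\mathcal E=\{H,\kappa\}\in\boldsymbol{\mathcal E}_{ell}}\Phi^{\mathcal E}(t).$$ (2) For every elliptic datum $\mathcal E=\{H,\kappa\}$ such that $T$ embeds in $H$, the stable orbital integral $\mathcal{SO}_H(\iota(t),f^{\mathcal E})$ has a germ expansion indexed by the set $\mathcal{SU}^H$ of stable unipotent conjugacy classes in $H(F)$: $$\mathcal{SO}_H(\iota(t),f^{\mathcal E})=\sum_{\boldsymbol{\tilde u}\in\mathcal{SU}^H}\mathcal S\Gamma^H_{\iota(z)u}(\iota(t))\,\mathcal{SO}_H(\iota(z)u,f^{\mathcal E}),$$ where $u$ is a representative of $\boldsymbol{\tilde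 u}$.
   Context: Groups and orbital integrals. $\widetilde G=GL(2)$, with center $\widetilde Z$; $\widetilde G$ acts on $G=SL(2)$ by conjugation. For $x\in G(F)$, $I_x$ is the centralizer of $x$ in $G$ and $\widetilde I_x$ its centralizer in $\widetilde G$. Haar measures are fixed on $G(F)$, $\widetilde G(F)$ and on the centralizers $I_x(F)$ (which are unimodular), and $\mathcal O_G(x,f)=\int_{I_x(F)\backslash G(F)}f(g^{-1}xg)\,d\dot g$; for $z\in Z(F)$ this means $\mathcal O_G(z,f)=f(z)$. For $\tilde g\in\widetilde G(F)$ the measure on $I_{\tilde g^{-1}x\tilde g}(F)$ is the one transported from $I_x(F)$ by conjugation. Let $Q_F=(F^\times)^2\backslash F^\times$, a compact group with Haar measure of total volume $1$, and $\mathcal K$ its Pontryagin dual. The determinant induces $\widetilde Z(F)G(F)\backslash\widetilde G(F)\simeq Q_F$. For $q\in Q_F$ put $x^q=\tilde g^{-1}x\tilde g$ where $\tilde g\in\widetilde G(F)$ maps to $q$ ($\mathcal O_G(x^q,f)$ does not depend on the choice of $\tilde g$). For $\kappa\in\mathcal K$, $$\mathcal O_G^\kappa(x,f)=\int_{Q_F}\kappa(q)\,\mathcal O_G(x^q,f)\,dq .$$ For $\kappa=1$ this is the stable orbital integral $\mathcal{SO}_G(x,f)$. If $H$ is a torus, conjugacy classes are singletons and $\mathcal{SO}_H(h,\varphi)=\varphi(h)$. Two elements of $G(F)$ are stably conjugate if they are conjugate in $G(\overline F)$, $\overline F$ an algebraic closure of $F$ (equivalently, conjugate under $\widetilde G(F)$).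 Quadratic extensions and tori. A separable quadratic extension $E/F$ may be split ($E=F\oplus F$, with $e\mapsto\overline e$ the exchange of coordinates); otherwise $e\mapsto\overline e$ is the nontrivial Galois automorphism. $T_{E/F}$ is the $F$-torus of norm-one elements in $\mathrm{Res}_{E/F}\mathbb G_m$, so $T_{E/F}(F)=E^1$ (norm one elements of $E^\times$). $\varepsilon_{E/F}$ is the character of $F^\times$ attached to $E/F$ by class field theory (the nontrivial character of $N_{E/F}E^\times\backslash F^\times$ if $E$ is a field, trivial if $E=F\oplus F$); it is viewed as an element of $\mathcal K$. Every maximal $F$-torus $T$ of $G$ is isomorphic to $T_{E/F}$ for a separable quadratic extension $E/F$, called the quadratic extension defined by $T$. Regular means regular semisimple. Endoscopic data. An endoscopic pair is $\mathcal E=\{H,\kappa\}$ equal to $\{G,1\}$ or $\{T_{E/F},\varepsilon_{E/F}\}$ with $E/F$ separable quadratic. It is an elliptic datum if it is $\{G,1\}$ or $\{T_{E/F},\varepsilon_{E/F}\}$ with $\varepsilon_{E/F}$ nontrivial (i.e. $E$ a field). $\boldsymbol{\mathcal E}_{ell}$ is the set of elliptic data (extensions $E/F$ taken up to isomorphism); it is in bijection with $\mathcal K$. An embedding $\iota:T\to H$ is an embedding of algebraic groups over $F$; it exists always if $H=G$ (e.g. the inclusion), and for $H=T_{E/F}$ only if $E$ is the quadratic extension defined by $T$. In the latter case $\overline\iota$ is the composition of $\iota$ with the Galois automorphism, so that $\iota(t),\overline\iota(t)$ are the eigenvalues of $t$. Transfer. Fix a regular element $\tau\in T(F)$ and a nonzero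 constant $c$. For $t\in T(F)$ regular, the transfer factor is $\Delta^{\mathcal E}(t)=1$ if $\mathcal E=\{G,1\}$, and $$\Delta^{\mathcal E}(t)=c\,\varepsilon_{E/F}\Big(\frac{\iota(t)-\overline\iota(t)}{\iota(\tau)-\overline\iota(\tau)}\Big)\,|\iota(t)-\overline\iota(t)|_E$$ if $\mathcal E=\{T_{E/F},\varepsilon_{E/F}\}$ and $T\simeq T_{E/F}$; here $|x|_E=|x\overline x|_F^{1/2}$ and the quotient lies in $F^\times$. An endoscopic transfer of $f$ is a function $f^{\mathcal E}\in\mathcal C_c^\infty(H(F))$ such that $\mathcal{SO}_H(\iota(t),f^{\mathcal E})=\Delta^{\mathcal E}(t)\,\mathcal O_G^\kappa(t,f)$ for every regular $t\in T(F)$. (When $H=G$ the measures on $T(F)$ and $\iota(T)(F)$ correspond under $\iota$.) It is known (Labesse–Langlands) that for every $f$ and $\mathcal E$ an endoscopic transfer $f^{\mathcal E}$ exists. Germs. Let $u_0=\begin{pmatrix}1&1\\0&1\end{pmatrix}$ and let $\boldsymbol{\tilde u_0}$ be its orbit under $\widetilde G(F)$-conjugacy. The set $\mathcal{SU}^G$ consists of $\{1\}$ and $\boldsymbol{\tilde u_0}$; for $H$ a torus $\mathcal{SU}^H$ consists of $\{1\}$ only. For $H=G$, $\mathcal S\Gamma^G_z:=\Gamma^{\widetilde G}_z$ and $\mathcal S\Gamma^G_{zu_0}:=\Gamma^{\widetilde G}_{zu_0}$ (also written $\mathcal S\Gamma^G_{z\boldsymbol{\tilde u_0}}$) are Shalika's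 germs for $\widetilde G(F)$: for a maximal torus $T$ of $G$ they are the functions of regular $t\in T(F)$ near $z$ (unique as germs at $z$, independent of $\varphi$; they exist by Shalika's theorem, which is valid for $GL(2)$ in any characteristic) such that for every $\varphi\in\mathcal C_c^\infty(\widetilde G(F))$ one has, for $t$ in a neighbourhood of $z$ depending on $\varphi$, $\mathcal O_{\widetilde G}(t,\varphi)=\Gamma^{\widetilde G}_z(t)\varphi(z)+\Gamma^{\widetilde G}_{zu_0}(t)\,\mathcal O_{\widetilde G}(zu_0,\varphi)$. Here $\mathcal O_{\widetilde G}(x,\varphi)=\int_{\widetilde I_x(F)\backslash\widetilde G(F)}\varphi(\tilde g^{-1}x\tilde g)\,d\dot{\tilde g}$ with the invariant measure normalized, for $x\in G(F)$, so that $\mathcal O_{\widetilde G}(x,\varphi)=\mathcal{SO}_G(x,\varphi|_{G(F)})$. For $H$ a torus the germ $\mathcal S\Gamma^H_{\iota(z)}$ is the constant function $1$. *)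

(* Defs.v *)
From HB Require Import structures.
From mathcomp Require Import all_boot all_order all_algebra all_field.
From mathcomp Require Import all_classical all_reals all_analysis.
From mathcomp Require Import complex.
From mathcomp Require mpoly.

Set Implicit Arguments.
Unset Strict Implicit.
Unset Printing Implicit Defensive.

Import Order.TTheory GRing.Theory Num.Theory.
Local Open Scope classical_set_scope.
Local Open Scope ring_scope.

(* No compatibility between the operations and the topology is built in here:
   it follows from [nonarch_local_field], which makes the topology that of an
   absolute value. *)
#[short(type="topFieldType")]
HB.structure Definition TopField := {F of GRing.Field F & Topological F}.

(* measurable types need a base point *)
#[non_forgetful_inheritance]
HB.instance Definition _ (F : topFieldType) := isPointed.Build (TopField.sort F) 0.

Section LocalField.
Variables (R : realType) (F : topFieldType) (abs : F -> R).

(* [abs] is the normalized absolute value: a uniformizer [pi] has absolute value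
   1/q, q the order of the residue field, given by a system [s] of
   representatives of the residue classes. *)
Record nonarch_local_field : Prop := NonarchLocalField {
  abs_ge0 : forall x, 0 <= abs x;
  abs_eq0 : forall x, abs x = 0 <-> x = 0;
  absM : forall x y, abs (x * y) = abs x * abs y;
  abs_ultrametric : forall x y, abs (x + y) <= Num.max (abs x) (abs y);
  abs_nbhs : forall x (U : set F),
    nbhs x U <-> exists2 e : R, 0 < e & [set y | abs (y - x) < e] `<=` U;
  abs_compact : compact [set x : F | abs x <= 1];
  abs_normalized : exists (pi : F) (s : seq F),
    [/\ pi != 0, forall x, abs x < 1 <-> abs x <= abs pi & abs pi = (size s)%:R^-1] /\
    [/\ uniq s, {in s, forall x, abs x <= 1},
        {in s &, forall x y, abs (x - y) < 1 -> x = y}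
      & forall x, abs x <= 1 -> exists2 y, y \in s & abs (x - y) < 1] }.

End LocalField.

(* Subgroups of GL(2) over a field [F], as functors of points. *)
Section AlgebraicGroups.
Variable F : fieldType.

Definition ptfun := forall A : comAlgType F, set 'M[A]_2.

(* the value at [g] of a polynomial over [F] in the four matrix entries *)
Definition peval (A : comAlgType F) (g : 'M[A]_2)
    (P : mpoly.mpoly (2 * 2) F) : A :=
  mpoly.mmap (GRing.in_alg A) (fun k => mxvec g 0 k) P.

Definition polymap := 'M[mpoly.mpoly (2 * 2) F]_2.

Definition mxeval (A : comAlgType F) (P : polymap) (g : 'M[A]_2) : 'M[A]_2 :=
  map_mx (peval g) P.

Definition SL2 : ptfun := fun A => [set g : 'M[A]_2 | \det g = 1].

Definition closed_subgroup (T : ptfun) : Prop :=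
  (exists S : set (mpoly.mpoly (2 * 2) F), forall A : comAlgType F,
     T A = [set g | forall P, S P -> peval g P = 0]) /\
  (forall A : comAlgType F,
     [/\ T A 1%:M, forall g h, T A g -> T A h -> T A (g *m h)
       & forall g, T A g -> exists2 h, T A h & g *m h = 1%:M]).

(* Maximal F-torus of SL(2): a closed F-subgroup which, over some finite Galois
   extension K of F, becomes SL(2, K)-conjugate to the diagonal torus.
   A K-algebra is an F-algebra with a morphism from K. *)
Definition maximal_torus (T : ptfun) : Prop :=
  [/\ closed_subgroup T,
      forall A : comAlgType F, T A `<=` @SL2 A
    & exists (K : splittingFieldType F) (g : 'M[K]_2),
        [/\ galois 1 {:K}, \det g = 1
          & forall (A : comAlgType F) (phi : {lrmorphism K -> A}),
              T A = [set map_mx phi g *m d *m map_mx phi (invmx g)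
                    | d in [set d : 'M[A]_2 | is_diag_mx d /\ \det d = 1]]]].

(* Homomorphism of algebraic groups over F that is a closed immersion: the
   coordinate functions of T are polynomials [Q] in those of the image, that
   is, F[H] -> F[T] is surjective. *)
Definition is_embedding (T H : ptfun) (P : polymap) : Prop :=
  [/\ forall (A : comAlgType F) (g : 'M[A]_2), T A g -> H A (mxeval P g),
      forall (A : comAlgType F) (g h : 'M[A]_2), T A g -> T A h ->
        mxeval P (g *m h) = mxeval P g *m mxeval P h
    & exists Q : polymap, forall (A : comAlgType F) (g : 'M[A]_2), T A g ->
        mxeval Q (mxeval P g) = g].

Definition embeds (T H : ptfun) : Prop := exists P, is_embedding T H P.

Definition rpts (T : ptfun) : set 'M[F]_2 := T F^o.

Definition rmap (P : polymap) (t : 'M[F]_2) : 'M[F]_2 :=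
  @mxeval F^o P t.

(* A separable quadratic field extension is E = F[X]/(p); E is realized as the
   algebra F[M] of 2x2 matrices (its regular representation on the basis 1, X),
   M the matrix of the multiplication by X. *)
Definition sep_quadratic (p : {poly F}) : Prop :=
  [/\ p \is monic, size p = 3, irreducible_poly p & separable_poly p].

Definition qgen (p : {poly F}) : 'M[F]_2 :=
  \matrix_(i, j) if j == 0 then (i != 0)%:R else - p`_i.

(* E (x) A *)
Definition qalg (p : {poly F}) (A : comAlgType F) : set 'M[A]_2 :=
  [set x | exists u v : A,
     x = u%:M + v *: map_mx (GRing.in_alg A) (qgen p) ].

Definition qext (p : {poly F}) : set 'M[F]_2 := @qalg p F^o.

(* In the regular representation, the norm of E/F is the determinant and the
   trace is the trace, whence the conjugation. *)
Definition qconj (x : 'M[F]_2) : 'M[F]_2 := (\tr x)%:M - x.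

(* T_{E/F} *)
Definition norm_one_torus (p : {poly F}) : ptfun :=
  fun A => [set x | qalg p x /\ \det x = 1].

Definition qext_iso (p p' : {poly F}) : Prop :=
  exists phi : {linear 'M[F]_2 -> 'M[F]_2},
    set_bij (qext p) (qext p') phi /\
    (forall x y, qext p x -> qext p y -> phi (x *m y) = phi x *m phi y).

(* Elliptic data: [None] is {G, 1} and [Some p] is {T_{E/F}, eps_{E/F}} for
   E = F[X]/(p). *)
Definition datum := option {poly F}.

(* [D] is the set of elliptic data, with one [p] for each isomorphism class of
   extensions. *)
Definition elliptic_data (D : set datum) : Prop :=
  [/\ D None,
      forall p, D (Some p) -> sep_quadratic p,
      forall p p', D (Some p) -> D (Some p') -> qext_iso p p' -> p = p'
    & forall p, sep_quadratic p -> (exists2 p', D (Some p') & qext_iso p p')].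

Definition endo_group (d : datum) : ptfun :=
  if d is Some p then norm_one_torus p else SL2.

Definition SLF : set 'M[F]_2 := rpts SL2.
Definition GLF : set 'M[F]_2 := [set g | g \in unitmx].
Definition SL_center : set 'M[F]_2 := [set z | SLF z /\ is_scalar_mx z].

(* g^-1 x g *)
Definition mconj (g x : 'M[F]_2) : 'M[F]_2 := invmx g *m x *m g.

Definition cent (H : set 'M[F]_2) (x : 'M[F]_2) : set 'M[F]_2 :=
  [set h | H h /\ h *m x = x *m h].

(* regular semisimple: distinct eigenvalues *)
Definition regular (x : 'M[F]_2) : Prop := separable_poly (char_poly x).

Definition u0 : 'M[F]_2 := \matrix_(i, j) (i <= j)%N%:R.

Definition GL_orbit (x : 'M[F]_2) : set 'M[F]_2 := [set mconj g x | g in GLF].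

(* stable unipotent conjugacy classes of H(F) *)
Definition SU (d : datum) : set (set 'M[F]_2) :=
  if d is Some _ then [set [set 1%:M]] else [set [set 1%:M]; GL_orbit u0].

(* x^q, computed with the element diag(q, 1) of determinant q *)
Definition qtwist (x : 'M[F]_2) (q : F) : 'M[F]_2 :=
  mconj (diag_mx (\row_j (if j == 0 then q else 1))) x.

(* the relations whose classes are the right cosets I g, resp. the classes of
   F^* modulo squares *)
Definition coset_rel (I : set 'M[F]_2) (g g' : 'M[F]_2) : Prop :=
  exists2 h, I h & g' = h *m g.

Definition square_rel (a b : F) : Prop := exists2 s : F, s != 0 & b = s ^+ 2 * a.

Definition units : set F := [set x | x != 0].

End AlgebraicGroups.

Section OrbitalIntegrals.
Variables (R : realType) (F : topFieldType).
Local Notation C := (complex R).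
Local Notation M2 := 'M[F]_2.

Definition cint d (X : measurableType d) (mu : {measure set X -> \bar R})
    (D : set X) (f : X -> C) : C :=
  Complex (\int[mu]_(x in D) complex.Re (f x)) (\int[mu]_(x in D) complex.Im (f x)).

Definition borel := g_sigma_algebraType (@open M2).

(* The open sets of the quotient of the subspace [X] by [r], identified with
   their inverse images in [X]. *)
Definition quot_open (T : topologicalType) (X : set T) (r : T -> T -> Prop) :
    set (set T) :=
  [set U : set T | (exists2 V, open V & U = X `&` V) /\
           (forall x y, X x -> X y -> r x y -> U x -> U y)].

(* Borel sigma-algebras of the quotients I\H and F^*2\F^*; functions on these
   are invariant functions on H, resp. F^*. *)
Definition quot_space (H I : set M2) :=
  g_sigma_algebraType (quot_open H (coset_rel I)).
Definition QF_space := g_sigma_algebraType (quot_open (@units F) (@square_rel F)).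

(* [f] (its restriction to [H]) belongs to C_c^oo(H) *)
Definition test_fun (H : set M2) (f : M2 -> C) : Prop :=
  (forall g, H g -> \forall h \near g, H h -> f h = f g) /\
  (exists K : set M2,
     [/\ compact K, K `<=` H & forall g, H g -> ~ K g -> f g = 0]).

(* Haar measure on the unimodular closed subgroup [H]; only its values on
   subsets of [H] matter. *)
Definition is_haar (H : set M2) (mu : {measure set borel -> \bar R}) : Prop :=
  [/\ forall K : set M2, compact K -> K `<=` H -> (mu K < +oo)%E,
      forall V : set M2, open V -> (V `&` H) !=set0 -> (0 < mu (V `&` H))%E,
      forall (h : M2) (A : set borel), H h -> measurable A -> A `<=` H ->
        mu [set (h *m a : M2) | a in A] = mu A
    & forall (h : M2) (A : set borel), H h -> measurable A -> A `<=` H ->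
        mu [set ((a : M2) *m h : M2) | a in A] = mu A].

Definition is_haar_QF (mu : {measure set QF_space -> \bar R}) : Prop :=
  mu (@units F) = 1%E /\
  (forall (c : F) (A : set QF_space), c != 0 -> measurable A ->
     A `<=` @units F -> mu [set (c * (a : F) : F) | a in A] = mu A).

(* The measures on G(F), on the centralizers I_x(F) and on Q_F.  The measure on
   I_x(F) is indexed by x and not by the group, because conjugation by an
   element that normalizes I_u(F), u unipotent, may dilate the measure; for x
   regular it depends only on the torus I_x. *)
Record measures := Measures {
  haarG : {measure set borel -> \bar R};
  haarI : M2 -> {measure set borel -> \bar R};
  haarQ : {measure set QF_space -> \bar R};
  haarG_haar : is_haar (@SLF F) haarG;
  haarI_haar : forall x, @SLF F x -> is_haar (cent (@SLF F) x) (haarI x);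
  haarI_conj : forall (x g : M2) (A : set borel), @SLF F x -> GLF g ->
    measurable A -> A `<=` cent (@SLF F) (mconj g x) ->
    haarI (mconj g x) A = haarI x [set (mconj (invmx g) a : M2) | a in A];
  haarI_torus : forall (x y : M2) (A : set borel), @SLF F x -> @SLF F y ->
    regular x -> regular y -> cent (@SLF F) x = cent (@SLF F) y ->
    measurable A -> A `<=` cent (@SLF F) x -> haarI x A = haarI y A;
  haarQ_haar : is_haar_QF haarQ }.

Variable m : measures.

(* The quotient of the measure of G(F) by that of I_x(F); it is unique. *)
Definition is_quotient_measure (x : M2)
    (nu : {measure set (quot_space (@SLF F) (cent (@SLF F) x)) -> \bar R}) : Prop :=
  forall phi : M2 -> C, test_fun (@SLF F) phi ->
    cint (haarG m) (@SLF F) phi =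
    cint nu (@SLF F) (fun g : M2 =>
      cint (haarI m x) (cent (@SLF F) x) (fun h : M2 => phi (h *m g))).

(* O_G(x, f): the integral of f(g^-1 x g) against the quotient measure *)
Definition orbint (x : M2) (f : M2 -> C) : C :=
  if `[< @SL_center F x >] then f x else
  xget 0 [set v : C | exists2 nu, @is_quotient_measure x nu &
    v = cint nu (@SLF F) (fun g : M2 => f (mconj g x))].

(* O_G^kappa(x, f) *)
Definition korbint (kappa : F -> C) (x : M2) (f : M2 -> C) : C :=
  cint (haarQ m) (@units F) (fun q : F => kappa q * orbint (qtwist x q) f).

Definition sorbint : M2 -> (M2 -> C) -> C := korbint (fun _ => 1).

(* SO_H *)
Definition SO (d : datum F) (h : M2) (phi : M2 -> C) : C :=
  if d is Some _ then phi h else sorbint h phi.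

(* Elements of the dual of Q_F, as functions on F^*.  They take only the values
   1 and -1, so that continuity means local constancy. *)
Definition QF_character (kappa : F -> C) : Prop :=
  [/\ forall x y, x != 0 -> y != 0 -> kappa (x * y) = kappa x * kappa y,
      forall x, x != 0 -> kappa (x ^+ 2) = 1
    & forall x, x != 0 -> kappa x != 0 /\ (\forall y \near x, kappa y = kappa x)].

(* eps_{E/F}, the nontrivial character of F^* / N E^*, which has order 2 by
   class field theory *)
Definition cft_character (p : {poly F}) (eps : F -> C) : Prop :=
  [/\ QF_character eps,
      (exists2 x, x != 0 & eps x != 1)
    & forall x, x != 0 ->
        (eps x = 1 <-> exists2 w, qext p w & \det w = x)].

Variable eps : {poly F} -> F -> C.

Definition endo_char (d : datum F) : F -> C :=
  if d is Some p then eps p else fun _ => 1.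

Variables (abs : F -> R) (c : C) (tau : M2).

(* Delta^E(t).  The quotient of iota(t) - conj by iota(tau) - conj is a scalar
   matrix, identified with its entry. *)
Definition transfer_factor (d : datum F) (iota : M2 -> M2) (t : M2) : C :=
  if d is Some p then
    let delta s := iota s - qconj (iota s) in
    c * eps p ((delta t *m invmx (delta tau)) 0 0)
      * (Num.sqrt (abs (\det (delta t))))%:C%C
  else 1.

Definition is_transfer (T : ptfun F) (f : M2 -> C) (d : datum F)
    (iota : M2 -> M2) (fd : M2 -> C) : Prop :=
  test_fun (rpts (endo_group d)) fd /\
  (forall t, rpts T t -> regular t ->
     SO d (iota t) fd = transfer_factor d iota t * korbint (endo_char d) t f).

(* Phi^E(t) *)
Definition Phi (T : ptfun F) (d : datum F) (iota : M2 -> M2) (fd : M2 -> C)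
    (t : M2) : C :=
  if `[< embeds T (endo_group d) >]
  then (transfer_factor d iota t)^-1 * SO d (iota t) fd else 0.

Variable nuGL : forall x : M2,
  {measure set (quot_space (@GLF F) (cent (@GLF F) x)) -> \bar R}.

Definition GL_orbint (x : M2) (phi : M2 -> C) : C :=
  cint (nuGL x) (@GLF F) (fun g : M2 => phi (mconj g x)).

(* [nuGL x] is invariant on the quotient of GL(2, F) by the centralizer of x,
   and normalized by the stable orbital integrals of SL(2, F). *)
Definition GL_quotient_measures : Prop :=
  forall x, @SLF F x ->
    (forall (g : M2) (A : set (quot_space (@GLF F) (cent (@GLF F) x))),
       GLF g -> measurable A -> A `<=` @GLF F ->
       nuGL x [set ((a : M2) *m g : M2) | a in A] = nuGL x A) /\
    (forall phi, test_fun (@GLF F) phi -> GL_orbint x phi = sorbint x phi).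

(* [Gam cl] is Shalika's germ attached to z cl, cl a unipotent class of
   GL(2, F), on the torus of SL(2) with set of F-points [S]. *)
Definition shalika_germs (S : set M2) (z : M2) (Gam : set M2 -> M2 -> C) : Prop :=
  forall phi, test_fun (@GLF F) phi ->
    \forall t \near z, S t -> regular t ->
      GL_orbint t phi = Gam [set 1%:M] t * phi z
        + Gam (GL_orbit (u0 F)) t * GL_orbint (z *m u0 F) phi.

(* the stable germ on H attached to iota(z) cl *)
Definition SGamma (d : datum F) (Gam : set M2 -> M2 -> C) (cl : set M2) (t : M2) : C :=
  if d is Some _ then 1 else Gam cl t.

End OrbitalIntegrals.

(* Main.v *)
Require Import Defs.
From HB Require Import structures.
From mathcomp Require Import all_boot all_order all_algebra all_field.
From mathcomp Require Import all_classical all_reals all_analysis.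
From mathcomp Require Import complex ring zify.
From mathcomp Require mpoly.
Import (canonicals) mpoly.

Set Implicit Arguments.
Unset Strict Implicit.
Unset Printing Implicit Defensive.

Import Order.TTheory GRing.Theory Num.Theory.
Local Open Scope classical_set_scope.
Local Open Scope ring_scope.

(** An embedding of [T] in SL(2) preserves traces: over a splitting field it is
    a homomorphism [s |-> M s] on the diagonal torus, with Laurent polynomial
    entries, hence [M s] is a sum of powers of [s] times orthogonal
    idempotents; Cayley-Hamilton shows that only two opposite exponents occur,
    and they are 1 and -1 because the embedding has a polynomial inverse.
    Hence [T] embeds in [T_{E/F}] exactly when [E] is generated by a regular
    element [t] of [T(F)], and this happens for at most one datum of the list.

    By the definition of the transfer, [Phi] at a datum in which [T] embeds is
    the kappa-orbital integral of [f].  Two twists of [t] by [q] and [q'] are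
    conjugate under SL(2, F) when [q / q'] is a determinant of an element of
    [F[t]^*].  If [t] has an eigenvalue in [F], every twist is conjugate to [t]
    and the stable orbital integral is the orbital integral.  Otherwise
    [q |-> O(t^q, f)] takes two values [A] and [B] on the two cosets of the
    norms, each of measure 1/2, and (A + B) / 2 + (A - B) / 2 = A.

    For the germs, a test function on SL(2, F) is extended to GL(2, F), where
    Shalika's expansion applies; on a torus the transfer is locally constant. *)

(** * Two by two matrices *)

Section Matrices22.
Variable A : comNzRingType.
Implicit Types X Y : 'M[A]_2.

Lemma mx22P X Y : X 0 0 = Y 0 0 -> X 0 1 = Y 0 1 -> X 1 0 = Y 1 0 ->
  X 1 1 = Y 1 1 -> X = Y.
Proof.
move=> h00 h01 h10 h11; apply/matrixP => i j.
have ord2 (k : 'I_2) : k = 0 \/ k = 1.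
  by case: k => [[|[|//]] hk]; [left|right]; apply: val_inj.
by case: (ord2 i) => ->; case: (ord2 j) => ->.
Qed.

Lemma mulmx22 X Y i j : (X *m Y) i j = X i 0 * Y 0 j + X i 1 * Y 1 j.
Proof. by rewrite mxE !big_ord_recl big_ord0 addr0; congr (_ + X _ _ * Y _ _);
  apply: val_inj. Qed.

Lemma det_mx22 X : \det X = X 0 0 * X 1 1 - X 0 1 * X 1 0.
Proof.
rewrite (expand_det_row _ 0) !big_ord_recl big_ord0 addr0 /cofactor !det_mx11 !mxE /=.
rewrite expr0 mul1r expr1 mulN1r mulrN.
by congr (_ * X _ _ - X _ _ * X _ _); apply: val_inj.
Qed.

Lemma mxtrace22 X : \tr X = X 0 0 + X 1 1.
Proof. by rewrite /mxtrace !big_ord_recl big_ord0 addr0; congr (_ + X _ _); apply: val_inj. Qed.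

Lemma Cayley_Hamilton22 X : X *m X = \tr X *: X - (\det X)%:M.
Proof. by apply: mx22P; rewrite !mulmx22 !mxE mxtrace22 det_mx22 /= ?mulr1n ?mulr0n; ring. Qed.

Definition mx22 (a b c d : A) : 'M[A]_2 :=
  \matrix_(i, j) if i == 0 then (if j == 0 then a else b)
                 else (if j == 0 then c else d).

(** Companion matrix of [X^2 - a X + b]: its trace is [a] and its determinant [b]. *)
Definition companion22 (a b : A) : 'M[A]_2 := mx22 0 (- b) 1 a.

(** The first basis vector is cyclic for the companion matrix, so a commuting matrix is known from
    its first column. No division occurs, which allows points over any [F]-algebra. *)
Lemma commute_companion22 a b X :
  X *m companion22 a b = companion22 a b *m X ->
  X = (X 0 0)%:M + X 1 0 *: companion22 a b.
Proof.
move=> h; have /matrixP hE := h.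
have := hE 0 0; have := hE 1 0.
rewrite !mulmx22 !mxE /= => h1 h2.
by apply: mx22P; rewrite !mxE /= ?mulr1n ?mulr0n; ring: h1 h2.
Qed.

End Matrices22.

(** * Conjugacy and regularity over a field *)

Section Fields22.
Variable F : fieldType.
Implicit Types X Y : 'M[F]_2.

(** Unless [X] is scalar, one of the two basis vectors or their sum is a cyclic vector [v], and in
    the basis [v], [X v] the matrix takes companion form. *)
Lemma nonscalar_conj_companion X : ~~ is_scalar_mx X ->
  exists2 C : 'M[F]_2, C \in unitmx & X *m C = C *m companion22 (\tr X) (\det X).
Proof.
move=> nX.
(* The hypothesis says that the determinant with columns [v] and [X v] is nonzero. *)
have cyc (v0 v1 : F) :
    v0 * (X 1 0 * v0 + X 1 1 * v1) - v1 * (X 0 0 * v0 + X 0 1 * v1) != 0 ->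
  exists2 C : 'M[F]_2, C \in unitmx & X *m C = C *m companion22 (\tr X) (\det X).
  move=> h; exists (mx22 v0 (X 0 0 * v0 + X 0 1 * v1) v1 (X 1 0 * v0 + X 1 1 * v1)).
    rewrite unitmxE det_mx22 !mxE /= unitfE.
    by apply: contra h => /eqP <-; apply/eqP; ring.
  by apply: mx22P; rewrite !mulmx22 !mxE ?mxtrace22 ?det_mx22 /=; ring.
have [h10|h10] := eqVneq (X 1 0) 0; last by apply: (cyc 1 0);
  rewrite !(mul1r, mulr1, mulr0, mul0r, addr0, subr0).
have [h01|h01] := eqVneq (X 0 1) 0; last first.
  by apply: (cyc 0 1); rewrite !(mul0r, mulr1, mul1r, mulr0, add0r, sub0r) oppr_eq0.
apply: (cyc 1 1); rewrite h10 h01 !(mul0r, mulr1, mul1r, add0r, addr0) subr_eq0.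
apply: contra nX => /eqP h; apply/is_scalar_mxP; exists (X 0 0).
by apply: mx22P; rewrite !mxE /= ?mulr1n ?mulr0n.
Qed.

Lemma char_poly22 X : char_poly X = 'X^2 - (\tr X) *: 'X + (\det X)%:P.
Proof.
rewrite /char_poly /char_poly_mx det_mx22 !mxE mxtrace22 det_mx22 /= ?mulr1n ?mulr0n
  -mul_polyC !rmorphD !rmorphN !rmorphM /=; ring.
Qed.

Definition disc22 X := \tr X ^+ 2 - 4%:R * \det X.

Lemma size_char_poly22 X : size (char_poly X) = 3.
Proof. exact: size_char_poly. Qed.

(** The square of the derivative minus four times the polynomial is the constant discriminant. If it
    is nonzero, this is a Bezout relation; if it is zero, the polynomial divides the square of its
    derivative. The argument covers characteristic 2. *)
Lemma separable_quadratic (a b : F) :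
  separable_poly ('X^2 - a *: 'X + b%:P) <-> a ^+ 2 - 4%:R * b != 0.
Proof.
set p := _ + _; have dp : p^`() = 2%:R *: 'X - a%:P.
  by rewrite /p derivD derivB derivZ derivXn derivX derivC addr0 -scaler_nat alg_polyC.
have e : (2%:R *: 'X - a%:P) * (2%:R *: 'X - a%:P) - 4%:R *: p = (a ^+ 2 - 4%:R * b)%:P.
  rewrite /p -!mul_polyC rmorphB rmorphXn rmorphM /= !rmorph_nat; ring.
have sp : size p = 3.
  rewrite /p -addrA size_polyDl size_polyXn // (leq_ltn_trans (size_polyD _ _)) //.
  rewrite gtn_max size_polyN (leq_ltn_trans (size_scale_leq _ _)) ?size_polyX //=.
  by rewrite (leq_ltn_trans (size_polyC_leq1 _)).
rewrite unlock dp; split=> [cop|nz]; last first.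
  apply/Bezout_eq1_coprimepP => /=.
  set k := (a ^+ 2 - 4%:R * b)^-1.
  exists (- (4%:R * k)%:P, k%:P * (2%:R *: 'X - a%:P)) => /=.
  have : k%:P * ((a ^+ 2 - 4%:R * b)%:P) = 1 :> {poly F} by rewrite -polyCM mulVf.
  rewrite -e -!mul_polyC polyCM; set r := _ - a%:P => h.
  by apply: etrans h; ring.
apply/negP => /eqP d0; move: e; rewrite d0 polyC0 => /eqP; rewrite subr_eq0 => /eqP e.
have : coprimep p ((2%:R *: 'X - a%:P) * (2%:R *: 'X - a%:P)).
  by rewrite coprimepMr cop.
rewrite e => /coprimepP /(_ p (dvdpp _)).
rewrite -mul_polyC dvdp_mull // => /(_ isT).
by move=> /eqp_size; rewrite sp size_poly1.
Qed.

Lemma regularE X : regular X <-> disc22 X != 0.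
Proof. by rewrite /regular char_poly22; apply: separable_quadratic. Qed.

Lemma regular_nonscalar X : regular X -> ~~ is_scalar_mx X.
Proof.
move=> /regularE; apply: contra => /is_scalar_mxP [a ->].
rewrite /disc22 mxtrace_scalar det_scalar; apply/eqP; ring.
Qed.

End Fields22.

(** * Laurent polynomial functions *)

Section LaurentFunctions.
Variable K : fieldType.
Hypothesis Kinf : forall n, exists2 s : seq K, uniq s & size s = n.

Lemma poly_eq0_nonzero_points (p : {poly K}) :
  (forall s : K, s != 0 -> p.[s] = 0) -> p = 0.
Proof.
move=> h; apply/eqP; apply: contraT => np.
(* The factor ['X] adds the root 0, so that ['X * p] vanishes on the whole field. *)
have [s us ss] := Kinf (size ('X * p)).
have := @max_poly_roots _ ('X * p) s; rewrite ss ltnn => -> //.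
  by rewrite mulf_neq0 ?polyX_eq0.
apply/allP => x _; rewrite /root hornerM hornerX.
by have [->|/h ->] := eqVneq x 0; rewrite ?mul0r ?mulr0.
Qed.

Lemma mx_poly_eq0 m n L (C : 'I_L -> 'M[K]_(m, n)) :
  (forall s : K, s != 0 -> \sum_(k < L) s ^+ k *: C k = 0) -> forall k, C k = 0.
Proof.
move=> h k; apply/matrixP => i j; rewrite [RHS]mxE.
pose p := \sum_(k < L) (C k i j) *: 'X^k : {poly K}.
have p0 : p = 0.
  apply: poly_eq0_nonzero_points => s /h /matrixP /(_ i j).
  rewrite [X in _ = X]mxE summxE horner_sum => e; rewrite -[RHS]e.
  by apply: eq_bigr => l _; rewrite !mxE hornerE hornerXn mulrC.
have := congr1 (fun q : {poly K} => q`_k) p0.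
rewrite coef0 coef_sum (bigD1 k) //= coefZ coefXn eqxx mulr1 big1 ?addr0 //.
by move=> l lk; rewrite coefZ coefXn eq_sym (inj_eq val_inj) (negPf lk) mulr0.
Qed.

(* [h s] is a Laurent polynomial in [s ^+ d] *)
Definition laurent (d : nat) (h : K -> K) :=
  exists N (p : {poly K}), forall s : K, s != 0 -> (s ^+ d) ^+ N * h s = p.[s ^+ d].

Lemma laurent_eq d h h' : (forall s : K, s != 0 -> h s = h' s) ->
  laurent d h -> laurent d h'.
Proof. by move=> e [N [p hp]]; exists N, p => s s0; rewrite -e ?hp. Qed.

Lemma laurent_cst d a : laurent d (fun=> a).
Proof. by exists 0, a%:P => s _; rewrite expr0 mul1r hornerC. Qed.

Lemma laurent_add d h h' : laurent d h -> laurent d h' -> laurent d (fun s => h s + h' s).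
Proof.
move=> [N [p hp]] [N' [p' hp']]; exists (N + N')%N, ('X^N' * p + 'X^N * p') => s s0.
rewrite !(hornerD, hornerN, hornerM, hornerZ, hornerC, hornerXn) -hp // -hp' // exprD;
  move: (s ^+ d) => x; ring.
Qed.

Lemma laurent_mul d h h' : laurent d h -> laurent d h' -> laurent d (fun s => h s * h' s).
Proof.
move=> [N [p hp]] [N' [p' hp']]; exists (N + N')%N, (p * p') => s s0.
rewrite hornerM -hp // -hp' // exprD; move: (s ^+ d) => x; ring.
Qed.

Lemma laurent_sum d I (r : seq I) (h : I -> K -> K) :
  (forall i, laurent d (h i)) -> laurent d (fun s => \sum_(i <- r) h i s).
Proof.
move=> hl; elim: r => [|i r IH].
  by apply: laurent_eq (laurent_cst d 0) => s _; rewrite big_nil.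
by apply: laurent_eq (laurent_add (hl i) IH) => s _; rewrite big_cons.
Qed.

Lemma laurent_prod d I (r : seq I) (h : I -> K -> K) :
  (forall i, laurent d (h i)) -> laurent d (fun s => \prod_(i <- r) h i s).
Proof.
move=> hl; elim: r => [|i r IH].
  by apply: laurent_eq (laurent_cst d 1) => s _; rewrite big_nil.
by apply: laurent_eq (laurent_mul (hl i) IH) => s _; rewrite big_cons.
Qed.

Lemma laurent_exp d h n : laurent d h -> laurent d (fun s => h s ^+ n).
Proof.
move=> hl; elim: n => [|n IH]; first exact: laurent_cst.
by apply: laurent_eq (laurent_mul hl IH) => s _; rewrite exprS.
Qed.

(** Clearing the denominator writes ['X^(d * N + 1)] as a polynomial in ['X^d], whose exponents are
    multiples of [d]; hence [d] divides 1. *)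
Lemma laurent_var d : laurent d id -> d = 1%N.
Proof.
move=> [N [p hp]].
have e : 'X^(d * N + 1) = p \Po 'X^d.
  apply/eqP; rewrite -subr_eq0; apply/eqP/poly_eq0_nonzero_points => s s0.
  by rewrite !(hornerD, hornerN, hornerXn) horner_comp hornerXn -hp // exprD exprM expr1 subrr.
have := congr1 (fun q : {poly K} => q`_(d * N + 1)) e.
rewrite coefXn eqxx; case: d {hp} e => [|d] e.
  by rewrite expr0 -polyC1 comp_polyCr coefC mul0n => /eqP; rewrite oner_eq0.
rewrite coef_comp_poly_Xn //; case: ifP => [|_ /eqP]; last by rewrite oner_eq0.
by rewrite dvdn_addr ?dvdn_mulr // dvdn1 => /eqP.
Qed.

Lemma laurent_mx_expansion (M : K -> 'M[K]_2) :
  (forall i j, laurent 1 (fun s => M s i j)) ->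
  exists N L (B : 'I_L -> 'M[K]_2),
    forall s : K, s != 0 -> s ^+ N *: M s = \sum_(k < L) s ^+ k *: B k.
Proof.
move=> hM.
have /choice [N hN] : forall ij : 'I_2 * 'I_2, exists N, exists p : {poly K},
    forall s : K, s != 0 -> s ^+ N * M s ij.1 ij.2 = p.[s].
  move=> [i j]; have [N [p hp]] := hM i j; exists N, p => s /hp.
  by rewrite expr1.
have /choice [p hp] := hN.
pose N0 := (\sum_ij N ij)%N.
pose q ij := 'X^(N0 - N ij) * p ij.
have hq s : s != 0 -> forall i j, s ^+ N0 * M s i j = (q (i, j)).[s].
  move=> s0 i j; rewrite hornerM hornerXn -(hp (i, j)) // mulrA -exprD subnK //.
  by rewrite /N0 (bigD1 (i, j)) //= leq_addr.
pose L := (\sum_ij size (q ij))%N.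
exists N0, L, (fun k => \matrix_(i, j) (q (i, j))`_k) => s s0.
apply/matrixP => i j; rewrite mxE hq // summxE.
have sL : (size (q (i, j)) <= L)%N by rewrite /L (bigD1 (i, j)) //= leq_addr.
rewrite (horner_coef_wide _ sL).
by apply: eq_bigr => k _; rewrite !mxE mulrC.
Qed.

(* [B k] is the coefficient of [s ^+ k] in [s ^+ N *: M s]; these are the
   orthogonal idempotents. *)
Lemma laurent_hom_trace (M : K -> 'M[K]_2) :
  (forall i j, laurent 1 (fun s => M s i j)) ->
  (forall s s' : K, s != 0 -> s' != 0 -> M (s * s') = M s *m M s') ->
  (forall s : K, s != 0 -> \det (M s) = 1) -> M 1 = 1%:M ->
  (forall d, (forall i j, laurent d (fun s => M s i j)) -> laurent d id) ->
  forall s : K, s != 0 -> \tr (M s) = s + s^-1.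
Proof.
move=> Ml MM Md M1 Minv.
have [N [L [B hB]]] := laurent_mx_expansion Ml.
(* Compare the coefficients of the powers of [s], then of [s'], in [M (s * s') = M s *m M s']. *)
have BB k l : B k *m B l = if k == l then B k else 0.
  have h s' : s' != 0 -> forall k, \sum_(l < L) s' ^+ l *: (B k *m B l) - s' ^+ k *: B k = 0.
    move=> s0'; apply: mx_poly_eq0 => s s0.
    have e1 : (\sum_(k < L) s ^+ k *: B k) *m (\sum_(l < L) s' ^+ l *: B l) =
        \sum_(k < L) (s * s') ^+ k *: B k.
      rewrite -!hB ?mulf_neq0 // MM // -scalemxAl -scalemxAr scalerA.
      by rewrite exprMn.
    apply/eqP; under eq_bigr do rewrite scalerBr.
    rewrite sumrB subr_eq0; apply/eqP.
    have -> : \sum_(i < L) s ^+ i *: (s' ^+ i *: B i) = \sum_(k < L) (s * s') ^+ k *: B k.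
      by apply: eq_bigr => i _; rewrite scalerA exprMn.
    rewrite -e1 mulmx_suml; apply: eq_bigr => i _.
    by rewrite -scalemxAl mulmx_sumr; congr (_ *: _); apply: eq_bigr => j _; rewrite scalemxAr.
  have h2 : forall l, B k *m B l - (if k == l then B k else 0) = 0.
    apply: (@mx_poly_eq0 _ _ _ (fun l => B k *m B l - (if k == l then B k else 0))) => s s0.
    rewrite -[RHS](h s s0 k); under eq_bigr do rewrite scalerBr.
    rewrite sumrB; congr (_ - _); rewrite (bigD1 k) //= eqxx big1 ?addr0 //.
    by move=> i ik; rewrite eq_sym (negPf ik) scaler0.
  by apply/eqP; rewrite -subr_eq0 h2.
have sumB : \sum_k B k = 1%:M.
  have := hB 1 (oner_neq0 _); rewrite expr1n scale1r M1 => ->.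
  by apply: eq_bigr => k _; rewrite expr1n scale1r.
have [k Bk] : exists k, B k != 0.
  apply/existsP; apply: contraT; rewrite negb_exists => /forallP h.
  move: sumB; rewrite big1 => [/matrixP /(_ 0 0)|k _]; last first.
    by have := h k; rewrite negbK => /eqP.
  by rewrite !mxE /= => /esym/eqP; rewrite oner_eq0.
have BM l s : s != 0 -> s ^+ N *: (B l *m M s) = s ^+ l *: B l.
  move=> s0; rewrite scalemxAr hB // mulmx_sumr (bigD1 l) //= big1 ?addr0.
    by rewrite -scalemxAr BB eqxx.
  by move=> i il; rewrite -scalemxAr BB eq_sym (negPf il) scaler0.
(* [M s] acts on [B l] as [s] to the power [l - N]; this is Cayley-Hamilton for [M s] multiplied by
   [B l], with denominators cleared. *)
have trE l s : s != 0 -> B l != 0 ->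
    s ^+ (2 * l) + s ^+ (2 * N) = \tr (M s) * s ^+ (N + l).
  move=> s0 Bl.
  have e1 : s ^+ (2 * N) *: (B l *m (M s *m M s)) = s ^+ (2 * l) *: B l.
    have -> : s ^+ (2 * N) = s ^+ N * s ^+ N by rewrite -exprD addnn mul2n.
    have -> : s ^+ (2 * l) = s ^+ l * s ^+ l by rewrite -exprD addnn mul2n.
    rewrite mulmxA -scalerA [X in s ^+ N *: X]scalemxAl (BM _ _ s0).
    by rewrite -scalemxAl scalerA [s ^+ N * s ^+ l]mulrC -[LHS]scalerA (BM _ _ s0) scalerA.
  have e2 : s ^+ (2 * N) *: (\tr (M s) *: (B l *m M s)) = (\tr (M s) * s ^+ (N + l)) *: B l.
    rewrite exprD mulrA -[RHS]scalerA -BM // !scalerA; congr (_ *: _).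
    by rewrite mul2n -addnn exprD; ring.
  move: e1; rewrite Cayley_Hamilton22 Md // mulmxBr mulmx1 -scalemxAr scalerBr e2 => e.
  have : (s ^+ (2 * l) + s ^+ (2 * N) - \tr (M s) * s ^+ (N + l)) *: B l = 0.
    by rewrite scalerBl scalerDl -e subrK subrr.
  by move=> /eqP; rewrite scaler_eq0 (negPf Bl) orbF subr_eq0 => /eqP.
(* Eliminating the trace between the relations for [k] and [l] gives a product of two differences of
   monomials equal to 0: the exponents [l - N] and [k - N] are equal or opposite. *)
have Bsupp l : B l != 0 -> l = k \/ (l + k = 2 * N)%N.
  move=> Bl.
  have e : ('X^k - 'X^l) * ('X^(l + k) - 'X^(2 * N)) = 0 :> {poly K}.
    apply: poly_eq0_nonzero_points => s s0.
    have := trE _ _ s0 Bl; have := trE _ _ s0 Bk;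
      rewrite !(hornerD, hornerN, hornerM, hornerZ, hornerC, hornerXn).
    rewrite !mul2n -!addnn !exprD => h1 h2.
    transitivity ((s ^+ k * s ^+ k + s ^+ N * s ^+ N) * s ^+ l -
                  (s ^+ l * s ^+ l + s ^+ N * s ^+ N) * s ^+ k); first by ring.
    by rewrite h1 h2; ring.
  move/eqP: e; rewrite mulf_eq0 !subr_eq0 => /orP[] /eqP /(congr1 (fun p : {poly K} => size p)).
    by rewrite !size_polyXn => -[/val_inj ->]; left.
  by rewrite !size_polyXn => -[->]; right.
(* The distance between [k] and [N], written with truncated subtractions. *)
pose d := (k - N + (N - k))%N.
have Mld i j : laurent d (fun s => M s i j).
  (* After multiplication by [s ^+ d], the exponents [-d] and [d] become 0 and [2 d], that is, the
     powers 0 and 2 of [s ^+ d]. *)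
  exists 1%N, (\sum_(l < L) (B l i j) *: 'X^(if (l + d == N)%N then 0 else 2)).
  move=> s s0; apply: (mulfI (expf_neq0 N s0)).
  have /matrixP /(_ i j) := hB s s0; rewrite mxE summxE => e.
  rewrite expr1 mulrCA e horner_sum !mulr_sumr; apply: eq_bigr => l _; rewrite mxE.
  have [->|Bl] := eqVneq (B l) 0; first by rewrite !mxE scale0r horner0 !mulr0.
  rewrite hornerZ hornerXn -exprM !mulrA -exprD [RHS]mulrC mulrA -exprD; congr (s ^+ _ * _).
  have : (l + d = N \/ l = N + d :> nat)%N.
    by case: (Bsupp _ Bl) => [lk|]; [rewrite lk /d|rewrite /d]; lia.
  by case: eqP; lia.
(* Invertibility of the homomorphism makes [s] itself a Laurent polynomial in [s ^+ d]. *)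
have d1 : d = 1%N by apply/laurent_var/Minv.
move=> s s0; have := trE _ _ s0 Bk.
have [kN|kN] : k = N.+1 :> nat \/ N = k.+1 :> nat by rewrite /d in d1; lia.
  rewrite kN => e; apply: (mulIf (expf_neq0 (N + N.+1) s0)).
  rewrite -e mulrDl -exprS [in s^-1 * _]addnS [in s^-1 * _]exprS mulKf //.
  by congr (s ^+ _ + s ^+ _); lia.
rewrite kN => e; apply: (mulIf (expf_neq0 (k.+1 + k) s0)).
rewrite -e addrC mulrDl -exprS [in s^-1 * _]addSn [in s^-1 * _]exprS mulKf //.
by congr (s ^+ _ + s ^+ _); lia.
Qed.

End LaurentFunctions.

(** * Maximal tori and embeddings *)

Section PolynomialMaps.
Variable F : fieldType.

Lemma peval_morph (A B : comAlgType F) (phi : {rmorphism A -> B}) :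
  (forall a : F, phi a%:A = a%:A) -> forall (g : 'M[A]_2) P,
  peval (map_mx phi g) P = phi (peval g P).
Proof.
move=> hphi g P; rewrite /peval /mpoly.mmap rmorph_sum; apply: eq_bigr => m _.
rewrite rmorphM /= hphi /mpoly.mmap1 rmorph_prod; congr (_ * _).
by apply: eq_bigr => i _; rewrite rmorphXn /= -map_mxvec mxE.
Qed.

Lemma mxeval_morph (A B : comAlgType F) (phi : {rmorphism A -> B}) :
  (forall a : F, phi a%:A = a%:A) -> forall (g : 'M[A]_2) P,
  mxeval P (map_mx phi g) = map_mx phi (mxeval P g).
Proof. by move=> hphi g P; apply/matrixP => i j; rewrite !mxE peval_morph. Qed.

(** The structure morphism, with source the regular algebra [F^o] because rational points are the
    points over [F^o]. *)
Definition base_map (A : comAlgType F) (a : F^o) : A := GRing.in_alg A a.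

Lemma base_map_zmod A : zmod_morphism (@base_map A).
Proof. by move=> a b; rewrite /base_map rmorphB. Qed.
HB.instance Definition _ A := GRing.isZmodMorphism.Build _ _ _ (@base_map_zmod A).
Lemma base_map_monoid A : monoid_morphism (@base_map A).
Proof. by split=> [|a b]; rewrite /base_map ?rmorph1 ?rmorphM. Qed.
HB.instance Definition _ A := GRing.isMonoidMorphism.Build _ _ _ (@base_map_monoid A).

Lemma base_mapA A (a : F) : base_map A (a%:A : F^o) = a%:A.
Proof. by rewrite /base_map /= /GRing.in_alg -[X in X *: _]/(a * 1) mulr1. Qed.

Lemma base_map_inj A : injective (base_map A).
Proof. exact: fmorph_inj. Qed.

Lemma laurent_peval (K : fieldExtType F) d (M : K -> 'M[K]_2) P :
  (forall i j, laurent d (fun s => M s i j)) -> laurent d (fun s => peval (M s) P).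
Proof.
move=> hM; rewrite /peval /mpoly.mmap; apply: laurent_sum => m.
apply: laurent_mul; first exact: laurent_cst.
apply: laurent_prod => k; apply: laurent_exp.
case/mxvec_indexP: k => i j.
by apply: laurent_eq (hM i j) => s _; rewrite mxvecE.
Qed.

Lemma laurent_mulmx (K : fieldType) d (M N : K -> 'M[K]_2) :
  (forall i j, laurent d (fun s => M s i j)) ->
  (forall i j, laurent d (fun s => N s i j)) ->
  forall i j, laurent d (fun s => (M s *m N s) i j).
Proof.
move=> hM hN i j; apply: (@laurent_eq _ d (fun s => M s i 0 * N s 0 j + M s i 1 * N s 1 j)).
  by move=> s _; rewrite mulmx22.
by apply: laurent_add; apply: laurent_mul.
Qed.

Definition torus22 (A : comNzRingType) (a b : A) := mx22 a 0 0 b.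

Lemma torus22M (A : comNzRingType) (a b a' b' : A) :
  torus22 a b *m torus22 a' b' = torus22 (a * a') (b * b').
Proof. by apply: mx22P; rewrite !mulmx22 !mxE /=; ring. Qed.

Lemma diag22P (A : comNzRingType) (d : 'M[A]_2) :
  is_diag_mx d -> d = torus22 (d 0 0) (d 1 1).
Proof. by move=> /is_diag_mxP h; apply: mx22P; rewrite !mxE //= h. Qed.

Lemma torus22_diag (A : comNzRingType) (a b : A) : is_diag_mx (torus22 a b).
Proof.
apply/is_diag_mxP => i j; rewrite !mxE.
by case: i j => [[|[|//]] ?] [[|[|//]] ?].
Qed.

(** * Points of a maximal torus and traces under an embedding *)

Section Torus.
Hypothesis Finf : forall n, exists2 s : seq F, uniq s & size s = n.
Variable T : ptfun F.
Hypothesis hT : maximal_torus T.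

Lemma torus_map (A B : comAlgType F) (phi : {rmorphism A -> B}) :
  (forall a : F, phi a%:A = a%:A) -> forall x, T x -> T (map_mx phi x).
Proof.
move=> hphi x; have [[[S hS] _] _ _] := hT; rewrite !hS /= => h P SP.
by rewrite peval_morph // h // rmorph0.
Qed.

(** [T] is cut out by equations with coefficients in [F], and these can be checked after an
    injective change of algebra. *)
Lemma torus_map_inj (A B : comAlgType F) (phi : {rmorphism A -> B}) :
  (forall a : F, phi a%:A = a%:A) -> injective phi ->
  forall x, T (map_mx phi x) -> T x.
Proof.
move=> hphi iphi x; have [[[S hS] _] _ _] := hT; rewrite !hS /= => h P SP.
by apply: iphi; rewrite rmorph0 -peval_morph // h.
Qed.

Lemma torus_det (A : comAlgType F) (x : 'M[A]_2) : T x -> \det x = 1.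
Proof. by have [_ h _] := hT => /h. Qed.

(** Over the splitting field [z] is diagonal of determinant 1 and is fixed by conjugation, so it
    lies in [T(K)]; then descend to [F]. *)
Lemma center_torus (z : 'M[F]_2) : SL_center z -> rpts T z.
Proof.
move=> [hz /is_scalar_mxP [a za]]; have [_ _ [K [g [_ dg hK]]]] := hT.
apply: (@torus_map_inj _ K (base_map K)); [exact: base_mapA|exact: base_map_inj|].
rewrite (hK _ idfun) /=; exists (map_mx (base_map K) z).
  split; last by rewrite det_map_mx hz rmorph1.
  by rewrite za map_scalar_mx /= scalar_mx_is_diag.
rewrite !map_mx_id // za map_scalar_mx /=.
by rewrite scalar_mxC -mulmxA mulmxV ?mulmx1 // unitmxE dg unitr1.
Qed.

(** Assuming only determinant one on [H] covers both SL(2) and the norm one tori. The trace is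
    computed over [K] by applying [laurent_hom_trace] to [P] along a parametrization of [T(K)]. *)
Lemma embedding_trace (H : ptfun F) P : is_embedding T H P ->
  (forall (A : comAlgType F) (x : 'M[A]_2), H A x -> \det x = 1) ->
  forall t, rpts T t -> \tr (rmap P t) = \tr t.
Proof.
move=> [PH PM [Q PQ]] Hdet t Tt; have [_ _ [K [g [_ dg hK]]]] := hT.
have gu : g \in unitmx by rewrite unitmxE dg unitr1.
have TK := hK _ (idfun : {lrmorphism K -> K}).
have Kinf n : exists2 s : seq K, uniq s & size s = n.
  have [s us ss] := Finf n; exists [seq base_map K x | x <- s].
    by rewrite map_inj_uniq //; exact: base_map_inj.
  by rewrite size_map.
(* The cocharacter that parametrizes [T(K)]. *)
pose D (s : K) := g *m torus22 s s^-1 *m invmx g.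
have TD s : s != 0 -> T (D s).
  move=> s0; rewrite TK /=; exists (torus22 s s^-1); last by rewrite !map_mx_id.
  split; first exact: torus22_diag.
  by rewrite det_mx22 !mxE /= mulfV // mulr0 subr0.
have DM s s' : D (s * s') = D s *m D s'.
  by rewrite /D !mulmxA mulmxKV // invfM -torus22M !mulmxA.
have lcst d (C : 'M[K]_2) i j : laurent d (fun=> C i j) by exact: laurent_cst.
have lD i j : laurent 1 (fun s => D s i j).
  rewrite /D; apply: laurent_mulmx => //; apply: laurent_mulmx => // {}i {}j.
  have [l0 l1] : laurent 1 (@id K) /\ laurent 1 (@GRing.inv K).
    split; first by exists 0%N, 'X => s _; rewrite expr0 mul1r hornerX expr1.
    by exists 1%N, 1 => s s0; rewrite !expr1 mulfV // hornerC.
  case: i j => [[|[|//]] ?] [[|[|//]] ?];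
    by [apply: laurent_eq l0 => s _; rewrite mxE | apply: laurent_eq l1 => s _; rewrite mxE
       | apply: laurent_eq (laurent_cst 1 0) => s _; rewrite mxE].
pose M s := mxeval P (D s).
have trM : forall s : K, s != 0 -> \tr (M s) = s + s^-1.
  apply: laurent_hom_trace => //.
  - by move=> i j; apply: laurent_eq (laurent_peval _ lD) => s _; rewrite mxE.
  - by move=> s s' s0 s0'; rewrite /M DM PM //; apply: TD.
  - by move=> s s0; apply: Hdet (PH _ _ (TD _ s0)).
  (* [M 1] is idempotent and invertible. *)
  - have D1 : D 1 = D 1 *m D 1 by rewrite -DM mulr1.
    have T1 := TD 1 (oner_neq0 _).
    have M1 : M 1 *m M 1 = M 1 by rewrite /M -PM // -D1.
    have uM : M 1 \in unitmx by rewrite unitmxE (Hdet _ _ (PH _ _ T1)) unitr1.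
    by rewrite -[LHS](mulKmx uM) M1 mulVmx.
  (* Undoing the embedding by [Q] and the conjugation by [g] recovers [s] as the upper left entry,
     polynomially in the entries of [M s]. *)
  move=> d lM.
  have lQ i j : laurent d (fun s => (invmx g *m mxeval Q (M s) *m g) i j).
    apply: laurent_mulmx => //; apply: laurent_mulmx => // {}i {}j.
    by apply: laurent_eq (laurent_peval _ lM) => s _; rewrite mxE.
  apply: laurent_eq (lQ 0 0) => s s0.
  rewrite PQ; last exact: TD.
  by rewrite /D -!mulmxA (mulVmx gu) mulmx1 (mulKmx gu) mxE.
have := torus_map (@base_mapA K) Tt.
rewrite TK /= => -[d [dd det1]]; rewrite !map_mx_id // => e.
have := det1; rewrite (diag22P dd) det_mx22 !mxE /= mulr0 subr0.
set s := d 0 0 => h.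
have s0 : s != 0 by apply: contraTneq isT => s0; move: h; rewrite s0 mul0r => /esym/eqP;
  rewrite oner_eq0.
have d11 : d 1 1 = s^-1 by apply: (mulfI s0); rewrite h mulfV.
have eD : map_mx (base_map K) t = D s by rewrite -e (diag22P dd) d11.
apply: (@base_map_inj K); rewrite -!trace_map_mx -mxeval_morph; last exact: base_mapA.
rewrite eD; transitivity (s + s^-1); first exact: trM.
by rewrite /D -mulmxA mxtrace_mulC (mulmxKV gu) mxtrace22 !mxE.
Qed.

End Torus.
End PolynomialMaps.

(** * Extension of scalars *)

Section BaseExtension.
Variables (F : fieldType) (A : comAlgType F) (h : {poly A}).

(** For [h] the image in [A[X]] of the minimal polynomial of a generator of [K], this is the tensor
    product of [A] and [K] over [F]. The instances below make it an [F]-algebra through [A]. *)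
Definition base_ext := {poly %/ h}.
HB.instance Definition _ := GRing.ComNzRing.on base_ext.

Definition base_ext_scale (a : F) (x : base_ext) : base_ext :=
  ((a%:A : A) *: (x : {poly %/ h}))%R.

Lemma base_ext_scaleA a b x :
  base_ext_scale a (base_ext_scale b x) = base_ext_scale (a * b) x.
Proof. by rewrite /base_ext_scale scalerA -[in RHS]scalerA mulr_algl. Qed.

Lemma base_ext_scale1 : left_id 1 base_ext_scale.
Proof. by move=> x; rewrite /base_ext_scale !scale1r. Qed.

Lemma base_ext_scaleDr : right_distributive base_ext_scale +%R.
Proof. by move=> a x y; rewrite /base_ext_scale scalerDr. Qed.

Lemma base_ext_scaleDl x : {morph base_ext_scale^~ x : a b / a + b}.
Proof. by move=> a b; rewrite /base_ext_scale !scalerDl. Qed.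

HB.instance Definition _ := GRing.Zmodule_isLmodule.Build F base_ext
  base_ext_scaleA base_ext_scale1 base_ext_scaleDr base_ext_scaleDl.

Lemma base_ext_scaleAl (a : F) (x y : base_ext) : a *: (x * y) = (a *: x) * y.
Proof. exact: qpoly_scaleAl. Qed.
HB.instance Definition _ := GRing.Lmodule_isLalgebra.Build F base_ext base_ext_scaleAl.

Lemma base_ext_scaleAr (a : F) (x y : base_ext) : a *: (x * y) = x * (a *: y).
Proof. exact: qpoly_scaleAr. Qed.
HB.instance Definition _ := GRing.Lalgebra_isAlgebra.Build F base_ext base_ext_scaleAr.

Definition base_extC (a : A) : base_ext := qpolyC h a.
HB.instance Definition _ := GRing.RMorphism.copy base_extC (qpolyC h).

Lemma base_extC_alg (a : F) : base_extC a%:A = a%:A.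
Proof. by apply: val_inj; rewrite /= -alg_polyC. Qed.

Lemma base_extC_inj : injective base_extC.
Proof. by move=> a b /(congr1 val) /= /polyC_inj. Qed.

End BaseExtension.

(** The diagonal form of a torus is given only over algebras receiving a morphism from [K]. Here any
    [F]-algebra is embedded in such an algebra, by writing [K] as generated by one separable
    element. *)
Lemma galois_base_extension (F : fieldType) (K : splittingFieldType F)
    (A : comAlgType F) : galois 1 {:K} ->
  exists (B : comAlgType F) (i : {rmorphism A -> B}) (phi : {lrmorphism K -> B}),
    injective i /\ forall a : F, i a%:A = a%:A.
Proof.
move=> /and3P[_ sepK _].
have gen := eq_adjoin_separable_generator sepK (sub1v _).
set al := separable_generator _ _ in gen.
have /polyOver1P [q hq] := minPolyOver 1%AS al.
pose h := map_poly (GRing.in_alg A) q.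
have mq : q \is monic by rewrite -(map_monic (GRing.in_alg K)) -hq monic_minPoly.
have sq : (1 < size q)%N.
  by rewrite -(size_map_poly (GRing.in_alg K)) -hq size_minPoly.
have mh : h \is monic by rewrite /h monic_map.
have sh : size h = size q.
  by rewrite /h size_map_poly_id0 // (monicP mq) /= scale1r oner_neq0.
(* The quotient is taken modulo [mk_monic h], which is [h] itself because [h] is monic and
   nonconstant. *)
have hE : mk_monic h = h by rewrite /mk_monic sh sq mh.
pose ev (P : {poly F}) : base_ext h := in_qpoly h (map_poly (GRing.in_alg A) P).
have ev0 P : (map_poly (GRing.in_alg K) P).[al] = 0 -> ev P = 0.
  move=> P0.
  have : q %| P.
    rewrite -(dvdp_map (GRing.in_alg K)) -hq; apply: minPoly_dvdp.
      by apply/polyOver1P; exists P.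
    by rewrite /root P0.
  move=> /dvdpP [c ->]; rewrite /ev rmorphM /= -/h; apply: val_inj.
  by rewrite /= hE Pdiv.RingMonic.rmodp_mull.
(* Each element of [K] is written as a polynomial in the generator; by [evE] the image in the
   quotient does not depend on the polynomial chosen. *)
have /choice [f hf] : forall x : K, exists P : {poly F}, x = (map_poly (GRing.in_alg K) P).[al].
  move=> x; have : x \in <<1; al>>%VS by rewrite -gen memvf.
  by move=> /Fadjoin_polyP [_ /polyOver1P [P ->] ->]; exists P.
have evE P Q : (map_poly (GRing.in_alg K) P).[al] = (map_poly (GRing.in_alg K) Q).[al] ->
  ev P = ev Q.
  move=> e; apply/eqP; rewrite -subr_eq0 -[_ - _]/(in_qpoly _ _ - in_qpoly _ _).
  rewrite -!raddfB /=; apply/eqP; apply: ev0.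
  by rewrite rmorphB hornerD hornerN e subrr.
pose psi x := ev (f x).
have psiB : zmod_morphism psi.
  move=> x y; rewrite /psi -[RHS]/(in_qpoly _ _ - in_qpoly _ _) -!raddfB /=.
  by apply: evE; rewrite -hf rmorphB hornerD hornerN -!hf.
have psiM : monoid_morphism psi.
  split=> [|x y].
    by rewrite -[RHS](in_qpoly1 h) -(rmorph1 (map_poly (GRing.in_alg A))); apply: evE;
      rewrite -hf rmorph1 hornerC.
  rewrite /psi -[RHS]/(in_qpoly _ _ * in_qpoly _ _) -in_qpolyM -rmorphM.
  by apply: evE; rewrite -hf rmorphM hornerM -!hf.
have psiZ : scalable psi.
  move=> a x; rewrite /psi; transitivity (ev (a *: f x)).
    by apply: evE; rewrite -hf -mul_polyC rmorphM hornerM /= map_polyC hornerC -hf mulr_algl.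
  by rewrite /ev map_polyZ in_qpolyZ.
pose m1 := GRing.isZmodMorphism.Build _ _ _ psiB.
pose m2 := GRing.isMonoidMorphism.Build _ _ _ psiM.
pose m3 := GRing.isScalable.Build _ _ _ _ _ psiZ.
pose Phi : {lrmorphism K -> base_ext h} := HB.pack psi m1 m2 m3.
exists (base_ext h), (@base_extC _ _ h), Phi.
by split; [exact: base_extC_inj | exact: base_extC_alg].
Qed.

(** * Quadratic extensions *)

Section Quadratic.
Variable F : fieldType.

Lemma det_lin22 (A : comNzRingType) (a b : A) (x : 'M[A]_2) :
  \det (a%:M + b *: x) = a ^+ 2 + a * b * \tr x + b ^+ 2 * \det x.
Proof. by rewrite !det_mx22 mxtrace22 !mxE /= ?mulr1n ?mulr0n; ring. Qed.

Lemma nonscalar_conj (x y : 'M[F]_2) : ~~ is_scalar_mx x -> ~~ is_scalar_mx y ->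
  \tr x = \tr y -> \det x = \det y ->
  exists2 C : 'M[F]_2, C \in unitmx & x *m C = C *m y.
Proof.
move=> /nonscalar_conj_companion [C Cu hC] /nonscalar_conj_companion [C' Cu' hC'] ht hd.
exists (C *m invmx C'); first by rewrite unitmx_mul Cu unitmx_inv.
have e : invmx C' *m y = companion22 (\tr y) (\det y) *m invmx C'.
  by rewrite -[LHS](mulmxK Cu') -(mulmxA _ y) hC' mulKmx.
by rewrite mulmxA hC ht hd -!mulmxA e.
Qed.

(** The map [x |-> C *m x *m C'], as polynomials in the entries of [x]. *)
Definition conj_map (C C' : 'M[F]_2) : polymap F :=
  \matrix_(i, j) \sum_k \sum_l
    (C i k * C' l j) *: mpoly.mpolyX F (mpoly.mnm1 (mxvec_index k l)).

Lemma mxeval_conj_map C C' (A : comAlgType F) (x : 'M[A]_2) :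
  mxeval (conj_map C C') x =
  map_mx (GRing.in_alg A) C *m x *m map_mx (GRing.in_alg A) C'.
Proof.
apply/matrixP => i j; rewrite !mxE /peval raddf_sum /=.
under [RHS]eq_bigr do rewrite mxE mulr_suml.
rewrite [RHS]exchange_big /=; apply: eq_bigr => k _.
rewrite raddf_sum /=; apply: eq_bigr => l _.
rewrite mpoly.mmapZ mpoly.mmapX mpoly.mmap1U mxvecE !mxE rmorphM /=; ring.
Qed.

Lemma qextP (p : {poly F}) x :
  qext p x <-> exists u v : F, x = u%:M + v *: qgen p.
Proof.
have e : map_mx (GRing.in_alg F^o) (qgen p) = qgen p.
  by apply/matrixP => i j; rewrite mxE /= /GRing.in_alg /= -[X in X = _]/(_ * 1) mulr1.
by split=> -[u [v ->]]; exists u, v; rewrite e.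
Qed.

Lemma qgenE (p : {poly F}) : qgen p = companion22 (- p`_1) p`_0.
Proof. by apply: mx22P; rewrite !mxE. Qed.

Lemma tr_qgen (p : {poly F}) : \tr (qgen p) = - p`_1.
Proof. by rewrite qgenE mxtrace22 !mxE /= add0r. Qed.

Lemma det_qgen (p : {poly F}) : \det (qgen p) = p`_0.
Proof. by rewrite qgenE det_mx22 !mxE /=; ring. Qed.

Lemma qgen_nonscalar (p : {poly F}) : ~~ is_scalar_mx (qgen p).
Proof.
apply/is_scalar_mxP => -[a /matrixP /(_ 1 0)]; rewrite !mxE /= => /eqP.
by rewrite oner_eq0.
Qed.

(** A nonscalar [x = u + v M] has [v] nonzero, so the generator [M] can be solved for in terms of
    [x]. *)
Lemma qext_lin (p : {poly F}) x : qext p x -> ~~ is_scalar_mx x ->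
  forall y, qext p y <-> exists a b : F, y = a%:M + b *: x.
Proof.
move=> /qextP [u [v ->]] nx y.
have v0 : v != 0.
  by apply: contraNneq nx => ->; rewrite scale0r addr0 scalar_mx_is_scalar.
split=> [/qextP [u' [v' ->]]|[a [b ->]]].
  exists (u' - v' / v * u), (v' / v); rewrite scalerDr scalerA divfK //.
  by rewrite addrA scale_scalar_mx -raddfD /= subrK.
apply/qextP; exists (a + b * u), (b * v).
by rewrite scalerDr scale_scalar_mx scalerA addrA -raddfD.
Qed.

Lemma qext_scalar (p : {poly F}) a : qext p a%:M.
Proof. by apply/qextP; exists a, 0; rewrite scale0r addr0. Qed.

Lemma qext_gen (p : {poly F}) : qext p (qgen p).
Proof. by apply/qextP; exists 0, 1; rewrite scale1r raddf0 add0r. Qed.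

(** [x] and [y] are conjugate, and the conjugation carries [F[x]] onto [F[y]]. *)
Lemma qext_iso_conj (p p' : {poly F}) x y : qext p x -> qext p' y ->
  ~~ is_scalar_mx x -> ~~ is_scalar_mx y -> \tr x = \tr y -> \det x = \det y ->
  qext_iso p p'.
Proof.
move=> px py nx ny ht hd; have [C Cu hC] := nonscalar_conj nx ny ht hd.
pose phi (M : 'M[F]_2) := invmx C *m M *m C.
have philin : linear phi.
  by move=> a M N; rewrite /phi mulmxDr mulmxDl -scalemxAr -scalemxAl.
pose m1 := GRing.isLinear.Build _ _ _ _ _ philin.
pose Phi : {linear 'M[F]_2 -> 'M[F]_2} := HB.pack phi m1.
have phix a b : phi (a%:M + b *: x) = a%:M + b *: y.
  rewrite /phi mulmxDr mulmxDl -scalemxAr -scalemxAl -(mulmxA _ x) hC mulKmx //.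
  by rewrite scalar_mxC -mulmxA mulVmx // mulmx1.
exists Phi; split; last by move=> M N _ _; rewrite /= /phi !mulmxA mulmxK.
split.
- by move=> _ /(qext_lin px nx) [a [b ->]]; rewrite /= phix; apply/(qext_lin py ny);
  exists a, b.
- move=> M N _ _ /= /(congr1 (fun X => C *m X *m invmx C)).
  by rewrite /phi !mulmxA mulmxV // !mul1mx !mulmxK.
- by move=> _ /(qext_lin py ny) [a [b ->]]; exists (a%:M + b *: x);
  [apply/(qext_lin px nx); exists a, b|exact: phix].
Qed.

(** An isomorphism fixes scalars, so the image of the generator satisfies the same quadratic
    equation. Comparing with its own Cayley-Hamilton equation identifies trace and determinant,
    since the image is not scalar. *)
Lemma qext_iso_gen (p p' : {poly F}) : qext_iso p p' ->
  exists y, [/\ qext p' y, ~~ is_scalar_mx y, \tr y = \tr (qgen p) & \det y = \det (qgen p)].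
Proof.
move=> [phi [[maps inj surj] phiM]]; exists (phi (qgen p)).
have p1 : phi 1%:M = 1%:M.
  have [y py y1] := surj _ (qext_scalar p' 1).
  by rewrite -[LHS]mul1mx -[X in X *m _]y1 -phiM ?mulmx1 //; exact: qext_scalar.
have pc a : phi a%:M = a%:M by rewrite -scalemx1 linearZ /= p1.
have ny : ~~ is_scalar_mx (phi (qgen p)).
  apply/is_scalar_mxP => -[a]; rewrite -pc => e.
  have := qgen_nonscalar p; rewrite (inj _ _ _ _ e) ?scalar_mx_is_scalar //.
    by rewrite inE; exact: qext_gen.
  by rewrite inE; exact: qext_scalar.
have := congr1 phi (Cayley_Hamilton22 (qgen p)).
rewrite phiM; [|exact: qext_gen..]; rewrite Cayley_Hamilton22 linearB linearZ /= pc => e.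
set y := phi _ in ny e *.
have ht : \tr y = \tr (qgen p).
  apply/eqP; rewrite -subr_eq0; apply: contraNT ny => nt.
  apply/is_scalar_mxP; exists ((\tr y - \tr (qgen p))^-1 * (\det y - \det (qgen p))).
  rewrite -scale_scalar_mx; apply: (scalerI nt); rewrite scalerA mulfV // scale1r.
  apply/matrixP => i j; move/matrixP: e => /(_ i j); rewrite !mxE => e.
  have swap (a b c d : F) : a - c = b - d -> a - b = c - d by move=> /(canRL (subrK _))
    ->; ring.
  by rewrite mulrBl mulrnBl; exact: swap.
split=> //; first exact: maps (qext_gen p).
move/eqP: e; rewrite ht (inj_eq (addrI _)) eqr_opp => /eqP /matrixP /(_ 0 0).
by rewrite !mxE /= !mulr1n.
Qed.

(** * Embeddings of a maximal torus in norm one tori *)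

Section TorusExt.
Hypothesis Finf : forall n, exists2 s : seq F, uniq s & size s = n.
Variable T : ptfun F.
Hypothesis hT : maximal_torus T.

(** After an injective extension to an algebra over [K], both elements are diagonal in the same
    basis. *)
Lemma torus_commute (A : comAlgType F) (x : 'M[A]_2) t : T x -> rpts T t ->
  x *m map_mx (GRing.in_alg A) t = map_mx (GRing.in_alg A) t *m x.
Proof.
move=> Tx Tt; have [_ _ [K [g [galK dg hK]]]] := hT.
have [B [i [phi [iinj ialg]]]] := galois_base_extension A galK.
have TixB := torus_map hT ialg Tx.
have TtB := torus_map hT (@base_mapA F B) Tt.
have e : map_mx i (map_mx (GRing.in_alg A) t) = map_mx (base_map B) t.
  by apply/matrixP => k l; rewrite !mxE /= ialg.
apply/matrixP => k l; apply: iinj.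
have -> : forall M : 'M[A]_2, i (M k l) = map_mx i M k l by move=> M; rewrite mxE.
rewrite -[RHS]/(i _) -[in RHS](_ : map_mx i (map_mx (GRing.in_alg A) t *m x) k l = i _);
  last by rewrite mxE.
rewrite !map_mxM e /=.
move: TixB TtB; rewrite !(hK _ phi) /= => -[d [dd _] <-] [d' [dd' _] <-].
have gV : map_mx phi (invmx g) *m map_mx phi g = 1%:M.
  by rewrite -map_mxM mulVmx ?map_mx1 // unitmxE dg unitr1.
congr (fun_of_matrix _ k l); rewrite !mulmxA; congr (_ *m _).
rewrite -!(mulmxA _ (map_mx phi (invmx g))) gV !mulmx1 -!mulmxA; congr (_ *m _).
by rewrite (diag22P dd) (diag22P dd') !torus22M mulrC [X in torus22 _ X]mulrC.
Qed.

Lemma embeds_qext (p : {poly F}) P t : is_embedding T (norm_one_torus p) P ->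
  rpts T t ->
  [/\ qext p (rmap P t), \tr (rmap P t) = \tr t & \det (rmap P t) = \det t].
Proof.
move=> emb Tt; have [PH _ _] := emb; have [h1 h2] := PH F^o t Tt.
split; first exact: h1.
  by apply: (embedding_trace Finf hT emb) => // A x [].
by rewrite [RHS](torus_det hT Tt).
Qed.

Lemma disc22E (x y : 'M[F]_2) : \tr x = \tr y -> \det x = \det y ->
  regular x -> regular y.
Proof. by move=> ht hd /regularE; rewrite /disc22 ht hd => /regularE. Qed.

(** Both extensions contain a nonscalar element with the trace and determinant of [t]. *)
Lemma embeds_unique (p p' : {poly F}) t :
  embeds T (norm_one_torus p) -> embeds T (norm_one_torus p') ->
  rpts T t -> regular t -> qext_iso p p'.
Proof.
move=> [P emb] [P' emb'] Tt rt.
have [px ht hd] := embeds_qext emb Tt; have [px' ht' hd'] := embeds_qext emb' Tt.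
have nx := regular_nonscalar (disc22E (esym ht) (esym hd) rt).
have nx' := regular_nonscalar (disc22E (esym ht') (esym hd') rt).
by apply: (qext_iso_conj px px' nx nx'); rewrite ?ht ?ht' ?hd ?hd'.
Qed.

Lemma noroot_sep_quadratic (t : 'M[F]_2) : regular t ->
  (forall a : F, a ^+ 2 - a * \tr t + \det t != 0) -> sep_quadratic (char_poly t).
Proof.
move=> rt h; split; [exact: char_poly_monic|exact: size_char_poly22| |exact: rt].
apply: cubic_irreducible => [|a]; first by rewrite size_char_poly22.
rewrite /root char_poly22 !(hornerD, hornerN, hornerZ, hornerC, hornerXn, hornerX).
by rewrite mulrC h.
Qed.

(** Conjugation by [C] sends [t] to a generator of the extension. As [T] commutes with [t], it is
    carried into the commutant of this generator, which is the extension itself. *)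
Lemma noroot_embeds (p : {poly F}) t : rpts T t -> regular t ->
  (forall a : F, a ^+ 2 - a * \tr t + \det t != 0) ->
  qext_iso (char_poly t) p -> embeds T (norm_one_torus p).
Proof.
move=> Tt rt h iso; have [y [py ny ht hd]] := qext_iso_gen iso.
have [mp sp _ _] := noroot_sep_quadratic rt h.
have tE : \tr (qgen (char_poly t)) = \tr t.
  by rewrite tr_qgen char_poly22 !coefE /=; ring.
have dE : \det (qgen (char_poly t)) = \det t.
  by rewrite det_qgen char_poly22 !coefE /=; ring.
have [C Cu hC] := nonscalar_conj (regular_nonscalar rt) ny (esym (etrans ht tE)) (esym
  (etrans hd dE)).
have CV (A : comAlgType F) : map_mx (GRing.in_alg A) C *m map_mx (GRing.in_alg A) (invmx
  C) = 1%:M.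
  by rewrite -map_mxM mulmxV // map_mx1.
have VC (A : comAlgType F) : map_mx (GRing.in_alg A) (invmx C) *m map_mx (GRing.in_alg A)
  C = 1%:M.
  by rewrite -map_mxM mulVmx // map_mx1.
exists (conj_map (invmx C) C); split.
- move=> A g Tg; rewrite mxeval_conj_map; split; last first.
    rewrite !det_mulmx (torus_det hT Tg) mulr1 -det_mulmx VC det1 //.
  have := torus_commute Tg Tt; set j := map_mx _; set x := _ *m j C => cg.
  have xy : x *m j y = j y *m x.
    have e : j t *m j C = j C *m j y by rewrite /j -!map_mxM hC.
    have e2 : j (invmx C) *m j t = j y *m j (invmx C).
      by rewrite -[LHS]mulmx1 -(CV A) mulmxA -(mulmxA _ (j t)) e mulmxA VC mul1mx.
    by rewrite /x -!mulmxA -e (mulmxA g) cg -!mulmxA !mulmxA e2.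
  have /qextP [u [v yE]] := py.
  have v0 : v != 0.
    by apply: contraNneq ny => v0; rewrite yE v0 scale0r addr0 scalar_mx_is_scalar.
  (* The generator [qgen p] is an affine function of [y], so [x] commutes with it as well. *)
  have xM : x *m j (qgen p) = j (qgen p) *m x.
    have -> : qgen p = (- u / v)%:M + v^-1 *: y.
      by rewrite yE scalerDr scalerA mulVf // scale1r scale_scalar_mx addrA -raddfD /=
        mulNr mulrC addNr raddf0 add0r.
    rewrite /j map_mxD map_mxZ map_scalar_mx mulmxDr mulmxDl -scalemxAr -scalemxAl xy.
    by rewrite scalar_mxC.
  have qE : j (qgen p) = companion22 ((- p`_1)%:A) ((p`_0)%:A).
    by rewrite qgenE; apply: mx22P; rewrite !mxE /= ?scale0r ?scale1r ?scaleNr.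
  rewrite qE in xM; exists (x 0 0), (x 1 0).
  by rewrite -/j qE; exact: commute_companion22 xM.
- by move=> A g g' _ _; rewrite !mxeval_conj_map !mulmxA -(mulmxA _ _ (map_mx _ (invmx
  C))) CV mulmx1.
exists (conj_map C (invmx C)) => A g _; rewrite !mxeval_conj_map.
by rewrite !mulmxA CV mul1mx -mulmxA CV mulmx1.
Qed.

Lemma embeds_norm (p : {poly F}) P t : is_embedding T (norm_one_torus p) P ->
  rpts T t -> regular t -> forall q,
  (exists2 w, qext p w & \det w = q) <-> exists a b : F, \det (a%:M + b *: t) = q.
Proof.
move=> emb Tt rt q; have [px ht hd] := embeds_qext emb Tt.
have nx := regular_nonscalar (disc22E (esym ht) (esym hd) rt).
split=> [[w /(qext_lin px nx) [a [b ->]] <-]|[a [b <-]]].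
  by exists a, b; rewrite !det_lin22 ht hd.
by exists (a%:M + b *: rmap P t); [apply/(qext_lin px nx);
  exists a, b | rewrite !det_lin22 ht hd].
Qed.

End TorusExt.
End Quadratic.

(** * Change of variables in integrals *)

Section Transport.
Context d1 d2 (X : measurableType d1) (Y : measurableType d2) (R : realType).
Variables (mu : {measure set X -> \bar R}) (nu : {measure set Y -> \bar R}).
Variables (phi : X -> Y) (psi : Y -> X) (D : set X) (E : set Y).
Hypotheses (phiK : cancel phi psi) (psiK : cancel psi phi).
Hypothesis mphi : forall A, measurable A -> measurable (phi @^-1` A).
Hypothesis mpsi : forall A, measurable A -> measurable (psi @^-1` A).
Hypothesis DE : forall x, E (phi x) <-> D x.
Hypothesis nuE : forall A, measurable A -> A `<=` E -> nu A = mu (phi @^-1` A).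

Import HBSimple HBNNSimple.

Lemma nnsfun_comp d d' (S : measurableType d) (S' : measurableType d')
    (k : S -> S') (h : {nnsfun S' >-> R}) :
  (forall A, measurable A -> measurable (k @^-1` A)) ->
  exists h' : {nnsfun S >-> R}, h' =1 h \o k.
Proof.
move=> mk.
have hm : measurable_fun setT (h \o k).
  move=> _ A mA; rewrite setTI comp_preimage; apply: mk.
  by rewrite -[_ @^-1` _]setTI; exact: measurable_funPT.
have hfin : finite_set (range (h \o k)).
  by apply: sub_finite_set (@fimfunP _ _ h) => _ [x _ <-]; exists (k x).
have hge : forall x, 0 <= (h \o k) x by move=> x; exact: fun_ge0.
pose m1 := isMeasurableFun.Build _ _ _ _ (h \o k) hm.
pose m2 := FiniteImage.Build _ _ (h \o k) hfin.
pose m3 := isNonNegFun.Build _ _ (h \o k) hge.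
pose H : {nnsfun S >-> R} := HB.pack (h \o k) m1 m2 m3.
by exists H.
Qed.

Lemma sintegral_transport (h : Y -> R) (h' : X -> R) :
  (forall r, measurable (h @^-1` [set r])) ->
  (forall y, ~ E y -> h y = 0) -> h' =1 h \o phi ->
  sintegral nu h = sintegral mu h'.
Proof.
move=> mh h0 /funext ->; rewrite !sintegralET; apply: eq_fsbigr => r _.
(* The value 0 contributes nothing, and the other level sets lie in [E], where [nu] is known. *)
have [->|r0] := eqVneq r 0; first by rewrite !mul0e.
rewrite nuE // => y /= hy; apply: contrapT => /h0; rewrite hy => /eqP.
by rewrite (negPf r0).
Qed.

(** Composition with [phi] and [psi] matches the simple functions below [g] with those below
    [g \o phi]. *)
Lemma nnintegral_transport (g : Y -> \bar R) : (forall y, ~ E y -> g y = 0%E) ->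
  ereal_sup [set sintegral nu h | h in [set h : {nnsfun Y >-> R} | forall y, ((h y)%:E <=
    g y)%E]] =
  ereal_sup [set sintegral mu h | h in [set h : {nnsfun X >-> R} | forall x, ((h x)%:E <=
    g (phi x))%E]].
Proof.
move=> g0; have hout (h : {nnsfun Y >-> R}) : (forall y, ((h y)%:E <= g y)%E) ->
    forall y, ~ E y -> h y = 0.
  move=> hg y Ey; apply/eqP; rewrite eq_le fun_ge0 andbT -lee_fin.
  by rewrite (le_trans (hg y)) // g0.
congr ereal_sup; apply/seteqP; split=> _ [h hg <-].
  have [h' h'E] := nnsfun_comp h mphi; exists h' => [x|]; first by rewrite h'E; exact: hg.
  by apply/esym/sintegral_transport => //; exact: hout.
have [h' h'E] := nnsfun_comp h mpsi.
have h'g y : ((h' y)%:E <= g y)%E by rewrite h'E /= -{2}(psiK y); exact: hg.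
exists h' => //; apply: sintegral_transport => //; first exact: hout.
by move=> x /=; rewrite h'E /= phiK.
Qed.

(* The simple functions below [f] are transported, because [f] may be an inner
   integral over a centralizer, whose measurability is not known. *)
Lemma integral_transport (f : Y -> \bar R) :
  (\int[nu]_(y in E) f y = \int[mu]_(x in D) f (phi x))%E.
Proof.
have e x : (f \_ E) (phi x) = ((f \o phi) \_ D) x.
  rewrite /patch; have [h|h] := boolP (phi x \in E).
    by rewrite ifT // inE; apply/DE; rewrite inE in h.
  by rewrite ifN // notin_setE => /DE Dx; move: h; rewrite notin_setE; apply.
have f0 y : ~ E y -> (f \_ E) y = 0%E.
  by move=> h; rewrite patchN // notin_setE.
rewrite /integral !nnintegral_transport; first last.
- by move=> y /f0 h; rewrite funeposE h maxxx.
- by move=> y /f0 h; rewrite funenegE h oppe0 maxxx.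
have e' : (f \_ E) \o phi = (f \o phi) \_ D by apply/funext => x; exact: e.
by rewrite -e' funepos_comp funeneg_comp.
Qed.

Lemma cint_transport (f : Y -> complex R) :
  cint nu E f = cint mu D (f \o phi).
Proof. by rewrite /cint /Rintegral !integral_transport. Qed.

End Transport.

Lemma eq_cint (R : realType) d (X : measurableType d) (mu : {measure set X -> \bar R})
    (D : set X) (f g : X -> complex R) :
  (forall x, D x -> f x = g x) -> cint mu D f = cint mu D g.
Proof.
by move=> h; rewrite /cint; congr Complex; apply: eq_Rintegral => x;
  rewrite inE => /h ->.
Qed.

Section GeneratedSigma.
Context (T T' : Type).

(** The sets with measurable preimage form a sigma-algebra that contains the generators. *)
Lemma g_sigma_preimage_measurable (G : set (set T)) (G' : set (set T')) (f : T -> T') :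
  (forall A, G' A -> <<s G >> (f @^-1` A)) ->
  forall A, <<s G' >> A -> <<s G >> (f @^-1` A).
Proof.
move=> h A; apply: (@smallest_sub _ (sigma_algebra setT) G' [set A | <<s G >> (f @^-1`
  A)]) => //.
split=> /=.
- by rewrite preimage_set0; exact: sigma_algebra0.
- by move=> B mB; rewrite setTD preimage_setC -setTD; exact: sigma_algebraCD.
- by move=> B mB; rewrite preimage_bigcup; exact: sigma_algebra_bigcup.
Qed.

End GeneratedSigma.

(** * Topology of a local field *)

Section LocalFieldTopology.
Variables (R : realType) (F : topFieldType) (abs : F -> R).
Hypothesis hF : nonarch_local_field abs.

Let ge0 := abs_ge0 hF.
Let eq0 := abs_eq0 hF.
Let M := absM hF.
Let ultra := abs_ultrametric hF.

Lemma abs1 : abs 1 = 1.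
Proof.
have h : abs 1 != 0 by apply/eqP => /eq0 /eqP; rewrite oner_eq0.
by apply: (mulfI h); rewrite -M !mulr1.
Qed.

Lemma absN x : abs (- x) = abs x.
Proof.
rewrite -mulN1r M; suff -> : abs (- 1) = 1 by rewrite mul1r.
by apply/eqP; rewrite -[_ == _](@eqrXn2 _ 2) // ?ler01 // expr2 -M mulrNN mulr1 abs1 expr1n.
Qed.

Lemma abs_gt0 x : x != 0 -> 0 < abs x.
Proof. by move=> x0; rewrite lt_def ge0 andbT; apply: contraNneq x0 => /eq0 ->. Qed.

Lemma abs_near (x : F) e : 0 < e -> \forall y \near x, abs (y - x) < e.
Proof. by move=> e0; apply/(abs_nbhs hF); exists e. Qed.

Lemma cvg_absP (T : Type) (G : set_system T) {FG : Filter G} (f : T -> F) (a : F) :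
  (f @ G --> a) <-> forall e, 0 < e -> \forall x \near G, abs (f x - a) < e.
Proof.
split=> [h e e0|h U /(abs_nbhs hF) [e e0 eU]].
  exact: h (abs_near a e0).
by apply: filterS (h e e0) => x; exact: eU.
Qed.

Lemma abs_lt x y e : abs x < e -> abs y < e -> abs (x + y) < e.
Proof. by move=> hx hy; rewrite (le_lt_trans (ultra x y)) // gt_max hx. Qed.

Lemma cvg_addF (T : Type) (G : set_system T) {FG : Filter G} (f g : T -> F) (a b : F) :
  f @ G --> a -> g @ G --> b -> (fun x => f x + g x) @ G --> a + b.
Proof.
move=> /cvg_absP hf /cvg_absP hg; apply/cvg_absP => e e0.
apply: filterS2 (hf e e0) (hg e e0) => x h1 h2.
by rewrite opprD addrACA abs_lt.
Qed.

Lemma cvg_mulF (T : Type) (G : set_system T) {FG : Filter G} (f g : T -> F) (a b : F) :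
  f @ G --> a -> g @ G --> b -> (fun x => f x * g x) @ G --> a * b.
Proof.
move=> /cvg_absP hf /cvg_absP hg; apply/cvg_absP => e e0.
have pos x : 0 < abs x + 1 by rewrite ltr_wpDl // ge0.
have e1 : 0 < e / (abs b + 1) by rewrite divr_gt0.
have e2 : 0 < e / (abs a + 1) by rewrite divr_gt0.
have small x y : abs x < e / (abs y + 1) -> abs (x * y) < e.
  move=> h; rewrite M; apply: (@le_lt_trans _ _ (abs x * (abs y + 1))).
    by rewrite ler_wpM2l ?ge0 // lerDl ler01.
  by rewrite -ltr_pdivlMr.
apply: filterS3 (hf _ e1) (hf _ ltr01) (filterI (hg _ e0) (hg _ e2)) => x h1 h2 [h3 h4].
have -> : f x * g x - a * b = (f x - a) * (g x - b) + ((f x - a) * b + (g x - b) * a).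
  by ring.
apply: abs_lt; last by apply: abs_lt; exact: small.
rewrite M (le_lt_trans _ h3) // -[leRHS]mul1r ler_wpM2r ?ge0 // ltW //.
Qed.

Lemma cvg_invF (T : Type) (G : set_system T) {FG : Filter G} (f : T -> F) (a : F) :
  a != 0 -> f @ G --> a -> (fun x => (f x)^-1) @ G --> a^-1.
Proof.
move=> a0 /cvg_absP hf; apply/cvg_absP => e e0.
have pa := abs_gt0 a0.
have e1 : 0 < e * (abs a * abs a) by rewrite !mulr_gt0.
apply: filterS2 (hf _ pa) (hf _ e1) => x h1 h2.
(* By the ultrametric inequality the absolute value is constant near a nonzero point. *)
have fa : abs (f x) = abs a.
  apply/eqP; rewrite eq_le; apply/andP; split.
    have := ultra (f x - a) a; rewrite subrK => /le_trans; apply.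
    by rewrite ge_max lexx andbT ltW.
  have := ultra (f x) (- (f x - a)); rewrite absN opprB addrC subrK => h.
  move: h; rewrite le_max => /orP[//|] h.
  by have := le_lt_trans h h1; rewrite ltxx.
have fx0 : f x != 0 by apply/eqP => /eq0 h; move: pa; rewrite -fa h ltxx.
have -> : (f x)^-1 - a^-1 = (- (f x - a)) * (f x * a)^-1 by field; rewrite ?fx0 ?a0.
have hV : abs (f x * a)^-1 = (abs a * abs a)^-1.
  apply: (mulIf (lt0r_neq0 (mulr_gt0 pa pa))); rewrite mulVf ?lt0r_neq0 ?mulr_gt0 //.
  by rewrite -{1}fa -!M mulVf ?abs1 // mulf_neq0.
by rewrite M absN hV ltr_pdivrMr // mulr_gt0.
Qed.

Lemma cvg_eqF (T : Type) (G : set_system T) (f g : T -> F) (a : F) :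
  f =1 g -> f @ G --> a -> g @ G --> a.
Proof. by move=> /funext ->. Qed.

Lemma cvg_sumF (T : Type) (G : set_system T) {FG : Filter G} (I : Type) (r : seq I) (f :
  I -> T -> F)
    (a : I -> F) :
  (forall i, f i @ G --> a i) -> (fun x => \sum_(i <- r) f i x) @ G --> \sum_(i <- r) a i.
Proof.
move=> h; elim: r => [|i r IH].
  rewrite big_nil; apply: (@cvg_eqF _ _ (fun=> 0)) (cvg_cst _).
  by move=> x; rewrite big_nil.
rewrite big_cons; apply: cvg_eqF (cvg_addF (h i) IH).
by move=> x; rewrite big_cons.
Qed.

Lemma cvg_prodF (T : Type) (G : set_system T) {FG : Filter G} (I : Type) (r : seq I) (f :
  I -> T -> F)
    (a : I -> F) :
  (forall i, f i @ G --> a i) -> (fun x => \prod_(i <- r) f i x) @ G --> \prod_(i <- r) a i.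
Proof.
move=> h; elim: r => [|i r IH].
  rewrite big_nil; apply: (@cvg_eqF _ _ (fun=> 1)) (cvg_cst _).
  by move=> x; rewrite big_nil.
rewrite big_cons; apply: cvg_eqF (cvg_mulF (h i) IH).
by move=> x; rewrite big_cons.
Qed.

Lemma cvg_expF (T : Type) (G : set_system T) {FG : Filter G} (f : T -> F) (a : F) n :
  f @ G --> a -> (fun x => f x ^+ n) @ G --> a ^+ n.
Proof.
move=> h; elim: n => [|n IH].
  rewrite expr0; apply: (@cvg_eqF _ _ (fun=> 1)) (cvg_cst _).
  by move=> x; rewrite expr0.
rewrite exprS; apply: cvg_eqF (cvg_mulF h IH).
by move=> x; rewrite exprS.
Qed.

Lemma cvg_mxP (T : Type) (G : set_system T) {FG : Filter G} (f : T -> 'M[F]_2) (A : 'M[F]_2) :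
  (f @ G --> A) <-> forall i j, (fun x => f x i j) @ G --> A i j.
Proof.
split=> [h i j U hU|h U [P hP PU]].
  apply: (h [set B : 'M[F]_2 | U (B i j)]); exists (fun i' j' => if (i' == i) && (j' ==
    j) then U else setT).
    move=> i' j'; case: ifP => [/andP[/eqP -> /eqP ->] //|_]; exact: filterT.
  by move=> B /(_ i j); rewrite !eqxx.
have : \forall x \near G, forall i j, P i j (f x i j).
  by apply: filter_forall => i; apply: filter_forall => j; exact: h.
by apply: filterS => x hx; exact: PU.
Qed.

Lemma cvg_entry (A : 'M[F]_2) i j : (fun B : 'M[F]_2 => B i j) @ A --> A i j.
Proof. by have /cvg_mxP h : (fun B : 'M[F]_2 => B) @ A --> A by exact: cvg_id. Qed.

Lemma cvg_mulmx (T : Type) (G : set_system T) {FG : Filter G} (f g : T -> 'M[F]_2) (A B :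
  'M[F]_2) :
  f @ G --> A -> g @ G --> B -> (fun x => f x *m g x) @ G --> A *m B.
Proof.
move=> /cvg_mxP hf /cvg_mxP hg; apply/cvg_mxP => i j; rewrite mulmx22.
apply: cvg_eqF (cvg_addF (cvg_mulF (hf i 0) (hg 0 j)) (cvg_mulF (hf i 1) (hg 1 j))).
by move=> x; rewrite mulmx22.
Qed.

Lemma continuous_mulmxl (g : 'M[F]_2) : continuous (fun A : 'M[F]_2 => g *m A).
Proof.
move=> A; apply: (@cvg_mulmx _ (nbhs A) (nbhs_filter A) (fun=> g) (fun B => B) g A);
  last exact: cvg_id.
exact: cvg_cst.
Qed.

Lemma continuous_mconj (g : 'M[F]_2) : continuous (mconj g).
Proof.
move=> A; apply: (@cvg_mulmx _ (nbhs A) (nbhs_filter A) (fun B => invmx g *m B) (fun=> g)).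
  exact: continuous_mulmxl.
exact: cvg_cst.
Qed.

Lemma continuous_det : continuous (fun A : 'M[F]_2 => \det A).
Proof.
have dE (B : 'M[F]_2) : \det B = B 0 0 * B 1 1 + (-1) * (B 0 1 * B 1 0).
  by rewrite det_mx22 mulN1r.
move=> A; apply: cvg_eqF (fun B => esym (dE B)) _; rewrite [X in _ --> X]dE.
apply: (@cvg_addF _ (nbhs A) (nbhs_filter A)).
  by apply: (@cvg_mulF _ (nbhs A) (nbhs_filter A)); exact: cvg_entry.
apply: (@cvg_mulF _ (nbhs A) (nbhs_filter A) (fun=> -1)); first exact: cvg_cst.
by apply: (@cvg_mulF _ (nbhs A) (nbhs_filter A)); exact: cvg_entry.
Qed.

Lemma continuous_rmap P : continuous (@rmap F P).
Proof.
move=> A; apply/(@cvg_mxP _ (nbhs A) (nbhs_filter A)) => i j; rewrite /rmap /mxeval mxE.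
apply: (@cvg_eqF _ _ (fun B : 'M[F^o]_2 => peval B (P i j))) => [B|]; first by rewrite mxE.
rewrite /peval /mpoly.mmap.
apply: (@cvg_sumF _ (nbhs A) (nbhs_filter A) _ _ (fun mon (B : 'M[F]_2) =>
  GRing.in_alg F^o (mpoly.mcoeff mon (P i j)) * mpoly.mmap1 (fun k => mxvec B 0 k) mon)) => mon.
apply: (@cvg_mulF _ (nbhs A) (nbhs_filter A) (fun=> _)); first exact: cvg_cst.
rewrite /mpoly.mmap1.
apply: (@cvg_prodF _ (nbhs A) (nbhs_filter A) _ _ (fun k (B : 'M[F]_2) => mxvec B 0 k ^+
  (mpoly.fun_of_multinom mon k))) => k; apply: (@cvg_expF _ (nbhs A) (nbhs_filter A)).
case/mxvec_indexP: k => k l; rewrite mxvecE.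
apply: cvg_eqF (@cvg_entry A k l) => B; by rewrite mxvecE.
Qed.

Lemma open_units : open (@units F).
Proof.
rewrite openE => x x0; apply/(abs_nbhs hF); exists (abs x); first exact: abs_gt0.
move=> y /= h; apply/eqP => y0; move: h; rewrite y0 sub0r absN ltxx //.
Qed.

(** The powers of a uniformizer have distinct absolute values. Infinity of the field is what lets
    polynomial identities be read off from points. *)
Lemma local_field_infinite n : exists2 s : seq F, uniq s & size s = n.
Proof.
have [pi [s [[pi0 hpi _] _]]] := abs_normalized hF.
have pilt : abs pi < 1 by apply/hpi.
have absX k : abs (pi ^+ k) = abs pi ^+ k.
  by elim: k => [|k IH]; rewrite ?expr0 ?abs1 // !exprS M IH.
exists [seq pi ^+ k | k <- iota 0 n]; last by rewrite size_map size_iota.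
rewrite map_inj_uniq ?iota_uniq // => k l /(congr1 abs); rewrite !absX.
have hlt k' l' : (k' < l')%N -> abs pi ^+ l' < abs pi ^+ k'.
  by move=> h; rewrite ltr_iXn2l // abs_gt0.
by case: (ltngtP k l) => // /hlt h e; rewrite e ltxx in h.
Qed.

End LocalFieldTopology.

(** * Orbital integrals and conjugation *)

Section Conjugation.
Variable F : fieldType.
Implicit Types g h x : 'M[F]_2.

Lemma SLF_unit g : SLF g -> g \in unitmx.
Proof. by move=> hg; rewrite unitmxE (hg : \det g = 1) unitr1. Qed.

Lemma mconjM g h x : g \in unitmx -> h \in unitmx ->
  mconj g (mconj h x) = mconj (h *m g) x.
Proof.
move=> gu hu; rewrite /mconj; have -> : invmx (h *m g) = invmx g *m invmx h.
  have hgu : h *m g \in unitmx by rewrite unitmx_mul hu.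
  by rewrite -[RHS](mulmxK hgu) !mulmxA mulmxKV // mulVmx // mul1mx.
by rewrite !mulmxA.
Qed.

Lemma mconjK g : g \in unitmx -> cancel (mconj g) (mconj (invmx g)).
Proof.
move=> gu x; rewrite mconjM ?unitmx_inv // mulmxV // /mconj invmx1.
by rewrite mul1mx mulmx1.
Qed.

Lemma mconjVK g : g \in unitmx -> cancel (mconj (invmx g)) (mconj g).
Proof. by move=> gu x; rewrite -{1}(invmxK g) mconjK // unitmx_inv. Qed.

Lemma mconj_fix g x : g \in unitmx -> g *m x = x *m g -> mconj g x = x.
Proof. by move=> gu e; rewrite /mconj -mulmxA -e mulKmx. Qed.

Lemma mconj_mul g x y : g \in unitmx -> mconj g (x *m y) = mconj g x *m mconj g y.
Proof. by move=> gu; rewrite /mconj !mulmxA mulmxK. Qed.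

Lemma det_mconj g x : g \in unitmx -> \det (mconj g x) = \det x.
Proof.
move=> gu; rewrite /mconj !det_mulmx mulrC mulrA -det_mulmx mulmxV // det1.
by rewrite mul1r.
Qed.

Lemma SLF_mconj g x : g \in unitmx -> SLF (mconj g x) <-> SLF x.
Proof.
move=> gu; rewrite /SLF /rpts /SL2 /=.
by split=> h; [rewrite -(det_mconj x gu)|rewrite det_mconj].
Qed.

Lemma SLF_mul g h : SLF g -> SLF (g *m h) <-> SLF h.
Proof.
move=> hg; rewrite /SLF /rpts /SL2 /= det_mulmx (hg : \det g = 1).
by rewrite -[X in X * _ = _]/(1 : F) mul1r.
Qed.

Lemma SLF_inv g : SLF g -> SLF (invmx g).
Proof.
by move=> hg; rewrite /SLF /rpts /SL2 /= det_inv (hg : \det g = 1) invr1.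
Qed.

Lemma mconj_center g x : g \in unitmx -> SL_center x -> mconj g x = x.
Proof.
move=> gu [_ /is_scalar_mxP [a ->]]; apply: mconj_fix => //.
by rewrite scalar_mxC.
Qed.

Lemma SL_center_mconj g x : g \in unitmx -> SL_center (mconj g x) <-> SL_center x.
Proof.
move=> gu; split=> h; last by rewrite mconj_center.
by rewrite -(mconjK gu x) mconj_center // unitmx_inv.
Qed.

Lemma cent_mconj g x h : SLF g -> cent (@SLF F) (mconj g x) (mconj g h) <-> cent (@SLF F) x h.
Proof.
move=> hg; have gu := SLF_unit hg; rewrite /cent /=; split=> -[h1 h2].
  split; first by apply/(SLF_mconj h gu).
  by apply: (can_inj (mconjK gu)); rewrite !mconj_mul.
by split; [apply/(SLF_mconj h gu)|rewrite -!mconj_mul // h2].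
Qed.

End Conjugation.

(** * Invariance of orbital integrals and of stable orbital integrals *)

Section OrbitalIntegral.
Variables (R : realType) (F : topFieldType) (abs : F -> R).
Hypothesis hF : nonarch_local_field abs.
Variable m : measures R F.
Local Notation M2 := 'M[F]_2.
Local Notation C := (complex R).

Lemma borel_preimage (k : M2 -> M2) : continuous k ->
  forall A : set (borel F), measurable A -> measurable (k @^-1` A : set (borel F)).
Proof.
move=> /continuousP ck A mA; apply: g_sigma_preimage_measurable mA => B oB.
by apply: sub_sigma_algebra; exact: ck.
Qed.

Lemma quot_preimage (T T' : topologicalType) (X : set T) (X' : set T')
    (r : T -> T -> Prop) (r' : T' -> T' -> Prop) (k : T -> T') : continuous k ->
  (forall a, X' (k a) <-> X a) -> (forall a b, r a b -> r' (k a) (k b)) ->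
  forall A, <<s quot_open X' r' >> A -> <<s quot_open X r >> (k @^-1` A).
Proof.
move=> /continuousP ck kX kr; apply: g_sigma_preimage_measurable => B [[V oV ->] hB].
apply: sub_sigma_algebra; split.
  by exists (k @^-1` V); [exact: ck|apply/seteqP; split=> a /= [] /kX].
by move=> x y Xx Xy rxy h; apply: hB (kr _ _ rxy) h; apply/kX.
Qed.

Lemma haarG_left (g : M2) (f : M2 -> C) : SLF g ->
  cint (haarG m) (@SLF F) (fun a : M2 => f (g *m a)) = cint (haarG m) (@SLF F) f.
Proof.
move=> hg; have gu := SLF_unit hg.
symmetry; apply: (@cint_transport _ _ (borel F) (borel F) R (haarG m) (haarG m)
  (fun a : M2 => g *m a) (fun a : M2 => invmx g *m a)).
- exact: mulKmx.
- exact: mulKVmx.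
- exact: borel_preimage (@continuous_mulmxl _ _ _ hF g).
- exact: borel_preimage (@continuous_mulmxl _ _ _ hF (invmx g)).
- by move=> a; exact: SLF_mul.
move=> A mA AS; have [_ _ /(_ _ _ (SLF_inv hg) mA AS) <- _] := haarG_haar m.
congr (haarG m _); apply/seteqP; split=> [_ [a Aa <-] /=|a /= Aa].
  by rewrite mulKVmx.
by exists (g *m a) => //; rewrite mulKmx.
Qed.

Lemma haarI_transport (g x : M2) (f : M2 -> C) : SLF x -> SLF g ->
  cint (haarI m (mconj g x)) (cent (@SLF F) (mconj g x)) f =
  cint (haarI m x) (cent (@SLF F) x) (fun h : M2 => f (mconj g h)).
Proof.
move=> hx hg; have gu := SLF_unit hg.
apply: (@cint_transport _ _ (borel F) (borel F) R (haarI m x) (haarI m (mconj g x))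
  (mconj g) (mconj (invmx g))).
- exact: mconjK.
- exact: mconjVK.
- exact: borel_preimage (@continuous_mconj _ _ _ hF g).
- exact: borel_preimage (@continuous_mconj _ _ _ hF (invmx g)).
- by move=> a; exact: cent_mconj.
move=> A mA AS; rewrite (haarI_conj m hx gu mA AS).
congr (haarI m x _); apply/seteqP; split=> [_ [a Aa <-] /=|a /= Aa].
  by rewrite mconjVK.
by exists (mconj g a) => //; rewrite mconjK.
Qed.

Lemma haarQ_transport (c : F) (f : F -> C) : c != 0 ->
  cint (haarQ m) (@units F) (fun q : F => f (c * q)) = cint (haarQ m) (@units F) f.
Proof.
move=> c0.
have mc (a : F) : a != 0 -> forall A : set (QF_space F), measurable A ->
    measurable ((fun q : F => a * q) @^-1` A : set (QF_space F)).
  move=> a0; apply: quot_preimage.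
  - move=> x; apply: (@cvg_mulF _ _ _ hF _ (nbhs x) (nbhs_filter x) (fun=> a));
    [exact: cvg_cst|exact: cvg_id].
  - by move=> x; rewrite /units /= mulf_eq0 (negPf a0).
  - by move=> x y [s s0 ->]; exists s => //; rewrite mulrCA.
symmetry; apply: (@cint_transport _ _ (QF_space F) (QF_space F) R (haarQ m) (haarQ m)
  (fun q : F => c * q) (fun q : F => c^-1 * q)).
- by move=> q; rewrite mulKf.
- by move=> q; rewrite mulVKf.
- exact: mc.
- by apply: mc; rewrite invr_eq0.
- by move=> q; rewrite /units /= mulf_eq0 (negPf c0).
move=> A mA AS; have cV : c^-1 != 0 by rewrite invr_eq0.
have [_ /(_ _ _ cV mA AS) <-] := haarQ_haar m.
congr (haarQ m _); apply/seteqP; split=> [_ [a Aa <-] /=|a /= Aa].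
  by rewrite mulVKf.
by exists (c * a) => //; rewrite mulKf.
Qed.

(** Left multiplication by the inverse of [g] sends cosets of the centralizer of [x] to cosets of
    the centralizer of [mconj g x]; [nu'] is the image of [nu] under it. *)
Lemma quotient_measure_conj (g x : M2) (f : M2 -> C) nu : SLF x -> SLF g ->
  @is_quotient_measure R F m x nu ->
  exists2 nu', @is_quotient_measure R F m (mconj g x) nu' &
   cint nu (@SLF F) (fun a : M2 => f (mconj a x)) =
   cint nu' (@SLF F) (fun a : M2 => f (mconj a (mconj g x))).
Proof.
move=> hx hg hnu; have gu := SLF_unit hg; have hg' := SLF_inv hg.
pose k (a : M2) : M2 := invmx g *m a.
pose X := quot_space (@SLF F) (cent (@SLF F) x).
pose Y := quot_space (@SLF F) (cent (@SLF F) (mconj g x)).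
have kK : cancel k (mulmx g) by exact: mulKVmx.
have kVK : cancel (mulmx g) k by exact: mulKmx.
have mk (A : set Y) : measurable A -> measurable (k @^-1` A : set X).
  apply: quot_preimage; first exact: (@continuous_mulmxl _ _ _ hF (invmx g)).
    by move=> a; exact: SLF_mul.
  move=> a b [h hh ->]; exists (mconj g h); first exact/(cent_mconj x h hg).
  by rewrite /k /mconj !mulmxA mulmxK.
have mkV (A : set X) : measurable A -> measurable ((fun a : M2 => g *m a) @^-1` A : set Y).
  apply: quot_preimage; first exact: (@continuous_mulmxl _ _ _ hF g).
    by move=> a; exact: SLF_mul.
  move=> a b [h hh ->]; exists (mconj (invmx g) h).
    by rewrite -(mconjK gu x); apply/(cent_mconj _ _ hg').
  by rewrite /mconj invmxK !mulmxA mulmxKV.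
have mf : measurable_fun [set: X] (k : X -> Y).
  by move=> _ A mA; rewrite setTI; exact: mk.
pose nu' : {measure set Y -> \bar R} :=
  measure_function_pushforward__canonical__measure_function_Measure nu mf.
have tr (u : M2 -> C) : cint nu' (@SLF F) u = cint nu (@SLF F) (fun a : M2 => u (k a)).
  apply: (@cint_transport _ _ X Y R nu nu' k (mulmx g) _ _ kK kVK mk mkV) => //.
  by move=> a; exact: SLF_mul.
exists nu'; last first.
  rewrite tr; apply: eq_cint => a ha; rewrite mconjM //; last first.
    by apply: SLF_unit; apply/SLF_mul.
  by rewrite /k mulKVmx.
move=> phi hphi; rewrite tr.
have tphi : test_fun (@SLF F) (fun a : M2 => phi (k a)).
  have [hphi1 [K [cK KS phiK]]] := hphi; split.
    move=> a ha; have hka : SLF (k a) by apply/SLF_mul.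
    have : \forall b \near a, SLF (k b) -> phi (k b) = phi (k a).
      exact: (@continuous_mulmxl _ _ _ hF (invmx g) a _ (hphi1 _ hka)).
    by apply: filterS => b h hb; apply: h; apply/SLF_mul.
  exists [set g *m b | b in K]; split.
  - apply: continuous_compact cK; apply: continuous_subspaceT.
    exact: (@continuous_mulmxl _ _ _ hF g).
  - by move=> _ [b Kb <-]; apply/(SLF_mul b hg); exact: KS.
  - move=> a ha Ka; apply: phiK; first exact/SLF_mul.
    by move=> Kka; apply: Ka; exists (k a) => //; exact: kK.
(* The quotient formula for [nu'] results from that for [nu], the left invariance of [haarG] and the
   transport of [haarI] by conjugation. *)
rewrite -(haarG_left phi hg') (hnu _ tphi); apply: eq_cint => a _.
rewrite haarI_transport //; apply: eq_cint => h _.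
by rewrite /k /mconj -!mulmxA mulKVmx.
Qed.

(** The sets of values given by quotient measures for [x] and for its conjugate coincide, so [xget]
    picks the same value from both. *)
Lemma orbint_conj (s x : M2) (f : M2 -> C) : SLF x -> SLF s ->
  orbint m (mconj s x) f = orbint m x f.
Proof.
move=> hx hs; have su := SLF_unit hs; rewrite /orbint.
have cE : `[< SL_center (mconj s x) >] = `[< SL_center x >].
  by apply: asbool_equiv_eq; exact: SL_center_mconj.
rewrite cE; case: asboolP => [cx|_]; first by rewrite mconj_center.
congr (xget 0 _); apply/seteqP; split=> v [nu hnu ->]; last first.
  by have [nu' hnu' e] := quotient_measure_conj f hx hs hnu; exists nu'.
have hx' : SLF (mconj s x) by apply/SLF_mconj.
have := quotient_measure_conj f hx' (SLF_inv hs) hnu.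
by rewrite mconjK // => -[nu' hnu' e]; exists nu'.
Qed.

Lemma eq_orbint (x : M2) (f f' : M2 -> C) : SLF x ->
  (forall g, SLF g -> f g = f' g) -> orbint m x f = orbint m x f'.
Proof.
move=> hx e; rewrite /orbint; case: asboolP => _; first exact: e.
have h (nu : {measure set (quot_space (@SLF F) (cent (@SLF F) x)) -> \bar R}) :
    cint nu (@SLF F) (fun g : M2 => f (mconj g x)) =
    cint nu (@SLF F) (fun g : M2 => f' (mconj g x)).
  by apply: eq_cint => g hg; apply: e; apply/(SLF_mconj x (SLF_unit hg)).
by congr (xget 0 _); apply/seteqP; split=> v [nu hnu ->]; exists nu.
Qed.

(** The factorization [g = h *m g' *m s], with [s] in SL(2) and [h] fixing [x], shows that a twist
    depends on the determinant only modulo determinants of the centralizer of [x]. *)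
Lemma orbint_det (g g' h x : M2) (f : M2 -> C) : SLF x -> g \in unitmx ->
  g' \in unitmx -> h \in unitmx -> h *m x = x *m h ->
  \det g = \det h * \det g' -> orbint m (mconj g x) f = orbint m (mconj g' x) f.
Proof.
move=> hx gu gu' hu hc hd.
have hd0 : \det h != 0 by rewrite -unitfE -unitmxE.
have gd0 : \det g' != 0 by rewrite -unitfE -unitmxE.
pose s := invmx g' *m invmx h *m g.
have sS : SLF s.
  by rewrite /SLF /rpts /SL2 /= /s !det_mulmx !det_inv hd mulrA mulfVK ?mulVf //; field;
    rewrite hd0 gd0.
have gE : g = h *m g' *m s by rewrite /s !mulmxA mulmxK // mulmxV // mul1mx.
rewrite gE -(mconjM x (SLF_unit sS)); last by rewrite unitmx_mul hu.
rewrite orbint_conj //; last by apply/SLF_mconj => //; rewrite unitmx_mul hu.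
by rewrite -(mconjM x gu' hu) (mconj_fix hu hc).
Qed.

Definition diag_q1 (q : F) : M2 := diag_mx (\row_j (if j == 0 then q else 1)).

Lemma det_diag_q1 q : \det (diag_q1 q) = q.
Proof. by rewrite det_mx22 !mxE /= ?mulr1n ?mulr0n; ring. Qed.

Lemma diag_q1_unit q : q != 0 -> diag_q1 q \in unitmx.
Proof. by move=> q0; rewrite unitmxE det_diag_q1 unitfE. Qed.

Lemma SLF_qtwist x q : q != 0 -> @SLF F x -> SLF (qtwist x q).
Proof. by move=> q0 hx; apply/SLF_mconj => //; exact: diag_q1_unit. Qed.

Lemma cint_haarQ_cst (a : C) : cint (haarQ m) (@units F) (fun=> a) = a.
Proof.
have [h1 _] := haarQ_haar m; case: a => a b.
rewrite /cint !Rintegral_cst ?h1 /= ?mulr1 //.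
all: apply: sub_sigma_algebra; split; last by move=> x y.
all: by exists (@units F); [exact: open_units hF|rewrite setIid].
Qed.

Lemma sorbint_center (z : M2) (f : M2 -> C) : SL_center z -> sorbint m z f = f z.
Proof.
move=> hz; rewrite -[RHS]cint_haarQ_cst; apply: eq_cint => q q0.
rewrite mul1r /qtwist mconj_center //; last exact: diag_q1_unit.
by rewrite /orbint; case: asboolP.
Qed.

Lemma eq_sorbint (x : M2) (f f' : M2 -> C) : SLF x ->
  (forall g, SLF g -> f g = f' g) -> sorbint m x f = sorbint m x f'.
Proof.
move=> hx e; apply: eq_cint => q q0; congr (_ * _).
by apply: eq_orbint => //; exact: SLF_qtwist.
Qed.

(** Conjugation by [g] translates the twisting variable by [\det g], and the measure on [Q_F] is
    invariant. *)
Lemma sorbint_conj (g x : M2) (f : M2 -> C) : SLF x -> g \in unitmx ->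
  sorbint m (mconj g x) f = sorbint m x f.
Proof.
move=> hx gu; have gd0 : \det g != 0 by rewrite -unitfE -unitmxE.
rewrite /sorbint /korbint -[RHS](haarQ_transport _ gd0); apply: eq_cint => q q0.
congr (_ * _); rewrite /qtwist -/(diag_q1 q) -/(diag_q1 (\det g * q)) (mconjM x
  (diag_q1_unit q0) gu).
apply: (@orbint_det _ _ 1%:M) => //.
- by rewrite unitmx_mul gu diag_q1_unit.
- by apply: diag_q1_unit; rewrite mulf_neq0.
- exact: unitmx1.
- by rewrite mul1mx mulmx1.
by rewrite det1 mul1r det_mulmx !det_diag_q1.
Qed.

End OrbitalIntegral.

(** * Sums over characters *)

Section KappaSum.
Variables (R : realType) (F : topFieldType) (abs : F -> R).
Hypothesis hF : nonarch_local_field abs.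
Variable m : measures R F.
Local Notation M2 := 'M[F]_2.
Local Notation C := (complex R).

Lemma quot_open_measurable (N : set F) : open N -> N `<=` @units F ->
  (forall x y, @square_rel F x y -> N x -> N y) ->
  measurable (N : set (QF_space F)).
Proof.
move=> oN NU Nsq; apply: sub_sigma_algebra; split.
  by exists N => //; apply/seteqP; split=> [x Nx|x []] //; split=> //; exact: NU.
by move=> x y _ _; exact: Nsq.
Qed.

Section TwoValues.
Variables (N : set F) (q0 : F).
Hypothesis mN : measurable (N : set (QF_space F)).
Hypothesis NU : N `<=` @units F.
Hypothesis q00 : q0 != 0.
Hypothesis Nq0 : forall x, x != 0 -> N (q0 * x) <-> ~ N x.

Let N' := [set x : F | x != 0 /\ ~ N x].

Let mU : measurable (@units F : set (QF_space F)).
Proof.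
apply: quot_open_measurable => //; first exact: open_units hF.
by move=> x y [s s0 ->]; rewrite /units /= => x0; rewrite mulf_neq0 // expf_neq0.
Qed.

Let mN' : measurable (N' : set (QF_space F)).
Proof.
have -> : N' = @units F `\` N by apply/seteqP; split=> x [].
exact: (@measurableD _ (QF_space F)).
Qed.

Let UE : @units F = N `|` N'.
Proof.
apply/seteqP; split=> [x x0|x [/NU|[]]] //.
by have [Nx|nNx] := pselect (N x); [left|right].
Qed.

Let muNE : (haarQ m N + haarQ m N' = 1)%E.
Proof.
have [<- _] := haarQ_haar m.
have disj : N `&` N' = set0 by apply/seteqP; split=> x //= [Nx [_ /(_ Nx)]].
by have := measureU (haarQ m) mN mN' disj; rewrite -UE => ->.
Qed.

(** Multiplication by [q0] exchanges [N] and its complement, so each has half of the total mass. *)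
Let muN' : haarQ m N' = haarQ m N.
Proof.
have [_ /(_ _ N' q00 mN') <-] := haarQ_haar m; last by move=> x [].
congr (haarQ m _); apply/seteqP; split=> [_ [x [x0 nNx] <-]|x Nx].
  exact/(Nq0 x0).
have x0 := NU Nx; have y0 : q0^-1 * x != 0 by rewrite mulf_neq0 // invr_eq0.
exists (q0^-1 * x); last by rewrite mulVKf.
by split=> //; apply/(Nq0 y0); rewrite mulVKf.
Qed.

Let muN : fine (haarQ m N) = 2^-1.
Proof.
have := muNE; rewrite muN'; case: (haarQ m N) => [r| |] //= [h].
by apply: (@mulIf _ 2); rewrite ?pnatr_eq0 // mulVf ?pnatr_eq0 // mulr_natr mulr2n.
Qed.

Lemma Rintegral_two_values (f : F -> R) (a b : R) :
  (forall x, N x -> f x = a) -> (forall x, x != 0 -> ~ N x -> f x = b) ->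
  Rintegral (haarQ m) (@units F) f = (a + b) / 2.
Proof.
move=> fa fb; rewrite /Rintegral.
have -> : (\int[haarQ m]_(x in @units F) (f x)%:E =
           \int[haarQ m]_(x in N `|` N') (f x)%:E)%E by rewrite -UE.
rewrite integral_setU_EFin //; first last.
- by rewrite disj_set2E; apply/eqP/seteqP; split=> x //= [Nx [_ /(_ Nx)]].
- apply/measurable_funU => //; split.
    by apply: (eq_measurable_fun (cst a)) => // x; rewrite inE => /fa.
  by apply: (eq_measurable_fun (cst b)) => // x; rewrite inE => -[x0 nNx]; rewrite fb.
have fin (A : set (QF_space F)) r : haarQ m A = haarQ m N -> (r%:E * haarQ m A = (r / 2)%:E)%E.
  move=> ->; have := muN; have := muNE; rewrite muN'.
  by case: (haarQ m N) => [s| |] //= _ ->.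
rewrite (@eq_integral _ _ _ _ _ (cst a%:E)); last by move=> x; rewrite inE => /fa ->.
rewrite [X in (_ + X)%E](@eq_integral _ _ _ _ _ (cst b%:E)); last first.
  by move=> x; rewrite inE => -[x0 nNx]; rewrite fb.
by rewrite !integral_cst // !fin //= mulrDl.
Qed.

Lemma cint_two_values (f : F -> C) (a b : C) :
  (forall x, N x -> f x = a) -> (forall x, x != 0 -> ~ N x -> f x = b) ->
  cint (haarQ m) (@units F) f =
  Complex ((complex.Re a + complex.Re b) / 2) ((complex.Im a + complex.Im b) / 2).
Proof.
move=> fa fb; rewrite /cint; congr Complex; apply: Rintegral_two_values => x.
- by move=> /fa ->.
- by move=> x0 /fb ->.
- by move=> /fa ->.
- by move=> x0 /fb ->.
Qed.

End TwoValues.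

Lemma cft_character_pm1 (p : {poly F}) (e : F -> C) x : cft_character p e -> x != 0 ->
  e x = 1 \/ e x = -1.
Proof.
move=> [[eM esq _] _ _] x0; have /eqP := esq _ x0.
rewrite expr2 eM // -expr2 sqrf_eq1 => /orP[] /eqP ->; by [left|right].
Qed.

Lemma korbint_sum (p : {poly F}) (e : F -> C) (t : M2) (f : M2 -> C) :
  cft_character p e -> SLF t ->
  (forall q, q != 0 -> e q = 1 -> exists a b : F, \det (a%:M + b *: t) = q) ->
  sorbint m t f + korbint m e t f = orbint m t f.
Proof.
move=> he ht hnorm; have [[eM esq eloc] [q0 q00 eq0] _] := he.
have pm := cft_character_pm1 he.
have eq0N : e q0 = -1 by case: (pm _ q00) => // h; rewrite h eqxx in eq0.
have N1 : (1 : C) <> -1.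
  by move=> /eqP; rewrite -subr_eq0 opprK -[1 + 1]/(2%:R) pnatr_eq0.
pose N := [set x : F | x != 0 /\ e x = 1].
have NU : N `<=` @units F by move=> x [].
have eN x : x != 0 -> ~ N x -> e x = -1.
  by move=> x0 nN; case: (pm _ x0) => // h; exfalso; apply: nN.
have mN : measurable (N : set (QF_space F)).
  apply: quot_open_measurable => //.
    rewrite openE => x [x0 ex]; have [_ h] := eloc _ x0.
    have ux : \forall y \near x, y != 0 by have := open_units hF; rewrite openE; apply.
    by apply: filterS2 ux h => y y0 ey; split=> //; rewrite ey.
  move=> x y [s s0 ->] [x0 ex]; have s20 : s ^+ 2 != 0 by rewrite expf_neq0.
  by split; [rewrite mulf_neq0|rewrite eM // esq // ex mulr1].
have Nq0 x : x != 0 -> N (q0 * x) <-> ~ N x.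
  move=> x0; split=> [[_]|nN].
    by rewrite eM // eq0N mulN1r => h [_ ex]; rewrite ex in h; exact/N1/esym.
  by split; [rewrite mulf_neq0|rewrite eM // eq0N (eN _ x0 nN) mulrNN mulr1].
(* When [e] agrees on [q] and [q'], their quotient is the determinant of some [a + b t], which
   commutes with [t]. *)
have tw q q' : q != 0 -> q' != 0 -> e q = e q' ->
    orbint m (qtwist t q) f = orbint m (qtwist t q') f.
  move=> x0 y0 exy; have z0 : q / q' != 0 by rewrite mulf_neq0 ?invr_eq0.
  have ez : e (q / q') = 1.
    have eq'0 : e q' != 0 by have [] := eloc _ y0.
    by apply: (mulIf eq'0); rewrite -eM // mulfVK // mul1r.
  have [a [b hab]] := hnorm _ z0 ez.
  apply: (@orbint_det _ _ _ hF _ _ _ (a%:M + b *: t)) => //.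
  - exact: diag_q1_unit.
  - exact: diag_q1_unit.
  - by rewrite unitmxE hab unitfE.
  - by rewrite mulmxDr mulmxDl -scalemxAl -scalemxAr scalar_mxC.
  - by rewrite !det_diag_q1 hab mulfVK.
have e1 : e 1 = 1 by rewrite -(expr1n F 2) esq // oner_neq0.
set A := orbint m t f; set B := orbint m (qtwist t q0) f.
have phiN x : N x -> orbint m (qtwist t x) f = A.
  move=> [x0 ex]; rewrite (tw _ 1) ?oner_neq0 ?e1 // /qtwist -/(diag_q1 1).
  have -> : diag_q1 (1 : F) = 1%:M by apply: mx22P; rewrite !mxE.
  by rewrite /mconj invmx1 mulmx1 mul1mx.
have phiN' x : x != 0 -> ~ N x -> orbint m (qtwist t x) f = B.
  by move=> x0 /(eN _ x0) ex; apply: tw => //; rewrite ex.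
rewrite /sorbint /korbint.
rewrite (@cint_two_values N q0 mN NU q00 Nq0 _ A B); first last.
- by move=> x x0 /phiN' -> //; rewrite mul1r.
- by move=> x /phiN ->; rewrite mul1r.
rewrite (@cint_two_values N q0 mN NU q00 Nq0 _ A (- B)); first last.
- by move=> x x0 nN; rewrite phiN' // eN // mulN1r.
- by move=> x Nx; rewrite phiN // (proj2 Nx) mul1r.
have ReN (w : C) : complex.Re (- w) = - complex.Re w by case: w.
have ImN (w : C) : complex.Im (- w) = - complex.Im w by case: w.
have CD (x y u v : R) : Complex x y + Complex u v = Complex (x + u) (y + v) by [].
rewrite ReN ImN CD; case: A {phiN} => a a' /=.
by congr Complex; field.
Qed.

Lemma sorbint_split (t : M2) (f : M2 -> C) (a : F) : SLF t -> regular t ->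
  a ^+ 2 - a * \tr t + \det t = 0 -> sorbint m t f = orbint m t f.
Proof.
move=> ht /regularE; rewrite /disc22 => rt ha.
rewrite -[RHS](cint_haarQ_cst hF m); apply: eq_cint => q q0; rewrite mul1r.
(* This is the difference of the eigenvalues [a] and [\tr t - a]; its square is the discriminant. *)
have d0 : a + a - \tr t != 0.
  apply: contra rt => /eqP h; have tE : \tr t = a + a by apply/eqP; rewrite eq_sym -subr_eq0 h.
  rewrite tE in ha *; apply/eqP; apply: etrans (_ : - 4%:R * (a ^+ 2 - a * (a + a) + \det
    t) = 0).
    by ring.
  by rewrite ha mulr0.
(* Chosen so that [(q - b * a) + b t] has eigenvalues [q] and 1, hence determinant [q]. *)
pose b := (q - 1) / (a + a - \tr t).
have -> : orbint m t f = orbint m (mconj 1%:M t) f.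
  by rewrite /mconj invmx1 mulmx1 mul1mx.
have hdet : \det ((q - b * a)%:M + b *: t) = q.
  rewrite det_lin22; have -> : \det t = a * \tr t - a ^+ 2.
    by apply/eqP; rewrite -subr_eq0 -ha; apply/eqP; ring.
  by rewrite /b; field.
apply: (@orbint_det _ _ _ hF _ _ _ ((q - b * a)%:M + b *: t)) => //.
- exact: diag_q1_unit.
- exact: unitmx1.
- by rewrite unitmxE hdet unitfE.
- by rewrite mulmxDr mulmxDl -scalemxAl -scalemxAr scalar_mxC.
- by rewrite det_diag_q1 hdet det1 mulr1.
Qed.

Lemma det_sub_qconj (x : M2) : \det (x - qconj x) = - disc22 x.
Proof. by rewrite /disc22 /qconj !det_mx22 mxtrace22 !mxE /= ?mulr1n ?mulr0n; ring. Qed.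

(** Writing the image of [t] as [a + b y], with [y] the image of [tau], the quotient inside the
    character is the nonzero scalar [b]; the absolute value is nonzero because [t] is regular. *)
Lemma transfer_factor_neq0 (T : ptfun F) eps (c : C) (tau : M2) (p : {poly F}) P t :
  maximal_torus T -> cft_character p (eps p) -> c != 0 ->
  is_embedding T (norm_one_torus p) P -> rpts T tau -> regular tau ->
  rpts T t -> regular t ->
  transfer_factor eps abs c tau (Some p) (rmap P) t != 0.
Proof.
move=> hT [[_ _ eloc] _ _] c0 emb Ttau rtau Tt rt.
have Finf := local_field_infinite hF.
have [px hx dx] := embeds_qext Finf hT emb Tt.
have [py hy dy] := embeds_qext Finf hT emb Ttau.
have rx := disc22E (esym hx) (esym dx) rt.
have ry := disc22E (esym hy) (esym dy) rtau.
have [a [b xE]] := (qext_lin py (regular_nonscalar ry) (rmap P t)).1 px.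
rewrite /transfer_factor; set x := rmap P t in rx xE *; set y := rmap P tau in ry xE *.
have b0 : b != 0.
  apply: contraNneq (regular_nonscalar rx) => b0.
  by rewrite xE b0 scale0r addr0 scalar_mx_is_scalar.
have dxy : x - qconj x = b *: (y - qconj y).
  by apply: mx22P; rewrite xE /qconj !mxE /= !mxtrace22 !mxE /= ?mulr1n ?mulr0n; ring.
have det0 (z : M2) : regular z -> \det (z - qconj z) != 0.
  by move=> /regularE; rewrite det_sub_qconj oppr_eq0.
have uy : y - qconj y \in unitmx by rewrite unitmxE unitfE det0.
have -> : ((x - qconj x) *m invmx (y - qconj y)) 0 0 = b.
  by rewrite dxy -scalemxAl mulmxV // !mxE /= mulr1.
rewrite !mulf_neq0 //; first by have [] := eloc _ b0.
have : 0 < Num.sqrt (abs (\det (x - qconj x))).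
  by rewrite sqrtr_gt0 (abs_gt0 hF) // det0.
by move=> h; rewrite (inj_eq (@complexI _)) lt0r_neq0.
Qed.

End KappaSum.

(** * Extension of test functions *)

Section Extension.
Variables (R : realType) (F : topFieldType) (abs : F -> R).
Hypothesis hF : nonarch_local_field abs.
Local Notation M2 := 'M[F]_2.
Local Notation C := (complex R).

Lemma cvg_mx22 (T : Type) (G : set_system T) {FG : Filter G} (a b c d : T -> F) (a' b' c'
  d' : F) :
  a @ G --> a' -> b @ G --> b' -> c @ G --> c' -> d @ G --> d' ->
  (fun x => mx22 (a x) (b x) (c x) (d x)) @ G --> mx22 a' b' c' d'.
Proof.
move=> ha hb hc hd; apply/cvg_mxP => i j; rewrite mxE.
case: i j => [[|[|//]] ?] [[|[|//]] ?] /=.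
- by apply: cvg_eqF ha => x; rewrite mxE.
- by apply: cvg_eqF hb => x; rewrite mxE.
- by apply: cvg_eqF hc => x; rewrite mxE.
- by apply: cvg_eqF hd => x; rewrite mxE.
Qed.

(* [diag(q, 1) g] *)
Definition scale_row (q : F) (g : M2) : M2 :=
  mx22 (q * g 0 0) (q * g 0 1) (g 1 0) (g 1 1).

Lemma det_scale_row q g : \det (scale_row q g) = q * \det g.
Proof. by rewrite !det_mx22 !mxE /=; ring. Qed.

Lemma scale_rowM q q' g : scale_row q (scale_row q' g) = scale_row (q * q') g.
Proof. by apply: mx22P; rewrite !mxE /= ?mulrA. Qed.

Lemma scale_row1 g : scale_row 1 g = g.
Proof. by apply: mx22P; rewrite !mxE /= ?mul1r. Qed.

Lemma cvg_scale_row (T : Type) (G : set_system T) {FG : Filter G} (q : T -> F) (g : T ->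
  M2) q' g' :
  q @ G --> q' -> g @ G --> g' ->
  (fun x => scale_row (q x) (g x)) @ G --> scale_row q' g'.
Proof.
move=> hq /cvg_mxP hg; apply: cvg_mx22; try exact: hg.
  exact: (cvg_mulF hF hq (hg 0 0)).
exact: (cvg_mulF hF hq (hg 0 1)).
Qed.

Lemma compact_scale_row (pi : F) (K : set M2) : compact K ->
  compact [set scale_row (1 + pi * xk.1) xk.2 | xk in [set x : F | abs x <= 1] `*` K].
Proof.
move=> cK; apply: continuous_compact (compact_setX (abs_compact hF) cK).
apply: continuous_subspaceT => -[x k].
have h1 : (fun xk : F * M2 => 1 + pi * xk.1) @ (x, k) --> 1 + pi * x.
  apply: (@cvg_addF _ _ _ hF _ (nbhs (x, k)) (nbhs_filter _) (fun=> 1)); first exact: cvg_cst.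
  apply: (@cvg_mulF _ _ _ hF _ (nbhs (x, k)) (nbhs_filter _) (fun=> pi)); first exact: cvg_cst.
  exact: cvg_fst.
have h2 : (fun xk : F * M2 => xk.2) @ (x, k) --> k by exact: cvg_snd.
exact: (@cvg_scale_row _ (nbhs (x, k)) (nbhs_filter _) _ _ _ _ h1 h2).
Qed.

(** Dividing the first row by the determinant maps GL(2) to SL(2). The extension is [f] composed
    with this map, cut off to determinants congruent to 1 modulo the maximal ideal. *)
Lemma test_fun_extend (f : M2 -> C) : test_fun (@SLF F) f ->
  exists2 phi, test_fun (@GLF F) phi & forall g, SLF g -> phi g = f g.
Proof.
move=> [floc [K [cK KS fK]]].
pose s (g : M2) := scale_row (\det g)^-1 g.
pose phi (g : M2) := if abs (\det g - 1) < 1 then f (s g) else 0.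
have detnear (g : M2) : \forall h \near g, abs (\det h - \det g) < 1.
  exact: (@continuous_det _ _ _ hF g _ (abs_near hF _ ltr01)).
have [pi [_ [[pi0 hpi _] _]]] := abs_normalized hF.
exists phi; last first.
  move=> g hg; have dg : \det g = 1 := hg.
  by rewrite /phi /s dg subrr ((abs_eq0 hF 0).2 erefl) ltr01 invr1 scale_row1.
split.
  move=> g gu; have d0 : \det g != 0 by rewrite -unitfE -unitmxE.
  rewrite /phi; case: ifPn => hg; last first.
    apply: filterS (detnear g) => h hh _; rewrite ifN //.
    apply: contra hg => h1.
    have -> : \det g - 1 = (\det h - 1) - (\det h - \det g) by ring.
    by apply: (abs_lt hF) => //; rewrite (absN hF).
  have sg : SLF (s g) by rewrite /SLF /rpts /SL2 /= det_scale_row mulVf.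
  have cs : s @ g --> s g.
    apply: (@cvg_scale_row _ (nbhs g) (nbhs_filter g)); last exact: cvg_id.
    exact: (@cvg_invF _ _ _ hF _ (nbhs g) (nbhs_filter g) (fun B : M2 => \det B) _ d0
      (@continuous_det _ _ _ hF g)).
  apply: filterS2 (detnear g) (cs _ (floc _ sg)) => h h1 h2 hu.
  rewrite ifT; last first.
    have -> : \det h - 1 = (\det h - \det g) + (\det g - 1) by ring.
    exact: (abs_lt hF).
  apply: h2; have h0 : \det h != 0 by rewrite -unitfE -unitmxE.
  by rewrite /SLF /rpts /SL2 /= det_scale_row mulVf.
(* The units congruent to 1 are the [1 + pi * x] with [x] integral; they form a compact set, and so
   do their products with [K]. *)
exists [set scale_row (1 + pi * xk.1) xk.2 | xk in [set x : F | abs x <= 1] `*` K].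
split; first exact: compact_scale_row.
  move=> _ [[x k] /= [x1 Kk] <-]; rewrite /GLF /= unitmxE det_scale_row.
  rewrite (KS _ Kk : \det k = 1) mulr1 unitfE; apply/eqP => h.
  have : abs (pi * x) < 1.
    by apply/hpi; rewrite (absM hF) -[leRHS]mulr1 ler_wpM2l ?(abs_ge0 hF).
  have -> : pi * x = - 1 by apply/eqP; rewrite -addr_eq0 addrC h.
  by rewrite (absN hF) (abs1 hF) ltxx.
move=> g gu ng; have d0 : \det g != 0 by rewrite -unitfE -unitmxE.
rewrite /phi; case: ifP => // hg; apply: fK.
  by rewrite /SLF /rpts /SL2 /= det_scale_row mulVf.
move=> Ksg; apply: ng; exists ((\det g - 1) / pi, s g); last first.
  by rewrite /= mulrC divfK // addrC subrK /s scale_rowM mulfV // scale_row1.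
split=> //=; rewrite (absM hF).
have pp : 0 < abs pi by rewrite (abs_gt0 hF).
have -> : abs pi^-1 = (abs pi)^-1.
  by apply: (mulfI (lt0r_neq0 pp)); rewrite -(absM hF) !mulfV ?(abs1 hF) ?lt0r_neq0.
by rewrite ler_pdivrMr // mul1r; apply/hpi.
Qed.

End Extension.

(** * Embeddings in SL(2) and the center *)

Section EmbeddingCenter.
Variable F : fieldType.
Hypothesis Finf : forall n, exists2 s : seq F, uniq s & size s = n.
Variable T : ptfun F.
Hypothesis hT : maximal_torus T.

Lemma SL2_id_embedding : embeds T (@SL2 F).
Proof.
exists (conj_map 1%:M 1%:M).
have e (A : comAlgType F) (g : 'M[A]_2) : mxeval (conj_map 1%:M 1%:M) g = g.
  by rewrite mxeval_conj_map !map_mx1 mul1mx mulmx1.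
split=> [A g Tg|A g h _ _|]; rewrite ?e //; first exact: (torus_det hT Tg).
by exists (conj_map 1%:M 1%:M) => A g _; rewrite !e.
Qed.

(** The image of [z = a] has square 1 and trace [a + a], so Cayley-Hamilton makes it scalar when
    [a + a] is nonzero. Otherwise [a = 1], and the identity maps to the identity. *)
Lemma embedding_center P z : is_embedding T (@SL2 F) P -> SL_center z ->
  SL_center (rmap P z).
Proof.
move=> emb hz; have Tz := center_torus hT hz; have [PH PM _] := emb.
have Sz : \det (rmap P z) = 1 := PH F^o z Tz; split; first exact: Sz.
have Rz : \det z = 1 by have [] := hz.
have [_ /is_scalar_mxP [a za]] := hz.
have a2 : a ^+ 2 = 1 by rewrite -Rz za det_scalar.
have T1 : rpts T 1%:M by have [[_ /(_ F^o) []]] := hT.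
have id1 : rmap P 1%:M = 1%:M.
  have M1 : rmap P 1%:M *m rmap P 1%:M = rmap P 1%:M.
    by have := PM F^o _ _ T1 T1; rewrite mulmx1 => /esym.
  have uM : rmap P 1%:M \in unitmx by rewrite unitmxE (PH F^o _ T1 : \det _ = 1) unitr1.
  by rewrite -[LHS](mulKmx uM) M1 mulVmx.
have sq : rmap P z *m rmap P z = 1%:M.
  rewrite -id1 -[LHS](PM F^o z z Tz Tz); congr rmap.
  by rewrite za -scalar_mxM -expr2 a2.
have htr : \tr (rmap P z) = a + a.
  rewrite (embedding_trace Finf hT emb) // za mxtrace22 !mxE /= !mulr1n //.
have := Cayley_Hamilton22 (rmap P z); rewrite sq Sz htr => CH.
have [h2|h2] := eqVneq (a + a) 0.
  have a1 : a = 1.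
    apply/eqP; rewrite -subr_eq0 -[_ == 0]orbb -mulf_eq0.
    have -> : (a - 1) * (a - 1) = (a + a) * a - (a + a) + (1 - a ^+ 2) by ring.
    by rewrite a2 h2 subrr mul0r subrr addr0.
  by apply/is_scalar_mxP; exists 1; rewrite za a1 id1.
apply/is_scalar_mxP; exists ((a + a)^-1 * 2).
apply: (scalerI h2); rewrite scale_scalar_mx mulVKf //.
have -> : (a + a) *: rmap P z = 1%:M + 1%:M by apply/eqP; rewrite -subr_eq -CH.
by rewrite -raddfD.
Qed.

End EmbeddingCenter.

(** * Endoscopic expansion and germs *)

Lemma fsbig_pair (R : nmodType) (I : choiceType) (a b : I) (f : I -> R) : a <> b ->
  \sum_(i \in [set a; b]) f i = f a + f b.
Proof.
move=> ab; rewrite fsbigU /= ?fsbig_set1 //.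
by move=> x [/= -> ].
Qed.

Section Endoscopy.
Variables (R : realType) (F : topFieldType) (abs : F -> R).
Hypothesis hF : nonarch_local_field abs.
Variable m : measures R F.
Variable T : ptfun F.
Hypothesis hT : maximal_torus T.
Variables (D : set (datum F)) (hD : elliptic_data D).
Local Notation M2 := 'M[F]_2.
Local Notation C := (complex R).

Lemma orbint_endoscopic_sum (eps : {poly F} -> F -> C) (f : M2 -> C) (c : C) (tau t : M2)
    (iota : datum F -> polymap F) (fE : datum F -> M2 -> C) :
  (forall p, sep_quadratic p -> cft_character p (eps p)) ->
  c != 0 -> rpts T tau -> regular tau ->
  (forall d, D d -> embeds T (endo_group d) -> is_embedding T (endo_group d) (iota d)) ->
  (forall d, D d -> embeds T (endo_group d) ->
    is_transfer m eps abs c tau T f d (rmap (iota d)) (fE d)) ->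
  rpts T t -> regular t ->
  orbint m t f = \sum_(d \in D) Phi m eps abs c tau T d (rmap (iota d)) (fE d) t.
Proof.
move=> heps c0 Ttau rtau hiota hfE Tt rt.
have Finf := local_field_infinite hF.
have [DN Dsep Duniq Dex] := hD.
have St : SLF t := torus_det hT Tt.
(* The transfer identity carries the same factor, which cancels because it is nonzero. *)
have PhiE d : D d -> embeds T (endo_group d) ->
    Phi m eps abs c tau T d (rmap (iota d)) (fE d) t = korbint m (endo_char eps d) t f.
  move=> Dd ed; rewrite /Phi asboolT // (hfE _ Dd ed).2 //; apply: mulKf.
  case: d Dd ed => [p|] Dd ed; last exact: oner_neq0.
  exact: (transfer_factor_neq0 hF hT (heps _ (Dsep _ Dd)) c0 (hiota _ Dd ed)).
have PhiN : Phi m eps abs c tau T None (rmap (iota None)) (fE None) t = sorbint m t f.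
  by rewrite PhiE //; exact: SL2_id_embedding.
have Phi0 p : ~ embeds T (norm_one_torus p) ->
    Phi m eps abs c tau T (Some p) (rmap (iota (Some p))) (fE (Some p)) t = 0.
  by move=> np; rewrite /Phi asboolF.
have [[p [Dp ep]]|noD] := pselect (exists p, D (Some p) /\ embeds T (norm_one_torus p)).
  (* By uniqueness of the extension, only [None] and [Some p] contribute. *)
  rewrite -(fsbig_widen [set None; Some p]) /=; first last.
  - move=> [p'|] [Dp' np']; last by case: np'; left.
    apply: Phi0 => ep'; apply: np'; right; congr Some.
    by apply: Duniq => //; exact: (embeds_unique Finf hT ep' ep Tt rt).
  - by move=> d [->|->].
  rewrite fsbig_pair // PhiN PhiE //=; apply/esym.
  have emb := hiota _ Dp ep; have hp := heps _ (Dsep _ Dp).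
  apply: (korbint_sum hF m f hp St) => q q0 eq1.
  by apply/(embeds_norm Finf hT emb Tt rt q); have [_ _ /(_ _ q0) [/(_ eq1)]] := hp.
rewrite -(fsbig_widen [set None]) /=; first last.
- move=> [p'|] [Dp' np']; last by case: np'.
  by apply: Phi0 => ep'; apply: noD; exists p'.
- by move=> d ->.
rewrite fsbig_set1 PhiN.
(* With only [None] contributing, [t] must have an eigenvalue in [F]: otherwise its characteristic
   polynomial defines an extension on the list in whose torus [T] embeds. *)
have [[a ha]|nroot] := pselect (exists a : F, a ^+ 2 - a * \tr t + \det t = 0).
  by rewrite (sorbint_split hF m f St rt ha).
have nroot' (a : F) : a ^+ 2 - a * \tr t + \det t != 0.
  by apply/eqP => h; apply: nroot; exists a.
have [p Dp iso] := Dex _ (noroot_sep_quadratic rt nroot').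
by case: noD; exists p; split => //; exact: (noroot_embeds hT Tt rt nroot' iso).
Qed.

Lemma torus_germ (p : {poly F}) P (h : M2 -> C) (z : M2) :
  is_embedding T (norm_one_torus p) P -> rpts T z ->
  test_fun (rpts (norm_one_torus p)) h ->
  \forall t \near z, rpts T t -> h (rmap P t) = h (rmap P z).
Proof.
move=> [PH _ _] Tz [hloc _].
have : \forall t \near z, rpts (norm_one_torus p) (rmap P t) -> h (rmap P t) = h (rmap P z).
  exact: (@continuous_rmap _ _ _ hF P z _ (hloc _ (PH F^o z Tz))).
by apply: filterS => t ht Tt; apply: ht; exact: (PH F^o t Tt).
Qed.

(** Extend [h] to GL(2), where orbital integrals are normalized as stable ones, and pull the germ
    neighbourhood back along the continuous map [rmap P]. Any [u] in the orbit of [u0] serves, by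
    invariance under GL(2). *)
Lemma stable_germ nuGL (Gam : set M2 -> M2 -> C) P (h : M2 -> C) (z u : M2) :
  @GL_quotient_measures R F m nuGL -> is_embedding T (@SL2 F) P -> SL_center z ->
  test_fun (@SLF F) h -> GL_orbit (u0 F) u ->
  shalika_germs nuGL [set rmap P t | t in rpts T] (rmap P z) Gam ->
  \forall t \near z, rpts T t -> regular t ->
    sorbint m (rmap P t) h =
      Gam [set 1%:M] (rmap P t) * sorbint m (rmap P z) h +
      Gam (GL_orbit (u0 F)) (rmap P t) * sorbint m (rmap P z *m u) h.
Proof.
move=> hnu emb hz th [g gu <-] hGam.
have Finf := local_field_infinite hF.
have cz := embedding_center Finf hT emb hz; have [Sz _] := cz.
have [phi tphi phiE] := test_fun_extend hF th.
have GLE x : SLF x -> GL_orbint nuGL x phi = sorbint m x h.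
  move=> Sx; have [_ e] := hnu x Sx; rewrite (e phi tphi).
  exact: (eq_sorbint m Sx phiE).
have Su : SLF (u0 F) by rewrite /SLF /rpts /SL2 /= det_mx22 !mxE /=; ring.
have H := @continuous_rmap _ _ _ hF P z _ (hGam _ tphi).
apply: (@filterS _ (nbhs z) (nbhs_filter z) _ _ _ H) => t ht Tt rt.
have St : SLF (rmap P t) by have [PH _ _] := emb; exact: (PH F^o t Tt).
rewrite -(GLE _ St) ht; first last.
- apply: (disc22E _ _ rt); last by rewrite (St : \det _ = 1) (torus_det hT Tt).
  by rewrite (embedding_trace Finf hT emb).
- by exists t.
have -> : phi (rmap P z) = sorbint m (rmap P z) h by rewrite (sorbint_center hF) // phiE.
have Szu : SLF (rmap P z *m u0 F) by apply/(SLF_mul _ Sz).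
rewrite (GLE _ Szu); suff -> : rmap P z *m mconj g (u0 F) = mconj g (rmap P z *m u0 F).
  by rewrite (sorbint_conj hF m h Szu gu).
by rewrite (mconj_mul _ _ gu) (mconj_center gu cz).
Qed.

End Endoscopy.

Theorem theorem7p3 (R : realType) (F : topFieldType) (abs : F -> R)
  (hF : nonarch_local_field abs)
  (m : measures R F)
  (nuGL : forall x : 'M[F]_2,
    {measure set (quot_space (@GLF F) (cent (@GLF F) x)) -> \bar R})
  (hnuGL : GL_quotient_measures m nuGL)
  (eps : {poly F} -> F -> complex R)
  (heps : forall p, sep_quadratic p -> cft_character p (eps p))
  (D : set (datum F)) (hD : elliptic_data D)
  (f : 'M[F]_2 -> complex R) (hf : test_fun (@SLF F) f)
  (z : 'M[F]_2) (hz : SL_center z)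
  (T : ptfun F) (hT : maximal_torus T)
  (c : complex R) (hc : c != 0)
  (tau : 'M[F]_2) (htau : rpts T tau) (rtau : regular tau)
  (iota : datum F -> polymap F)
  (hiota : forall d, D d -> embeds T (endo_group d) ->
    is_embedding T (endo_group d) (iota d))
  (iota_haar : forall (t : 'M[F]_2) (A : set (borel F)), rpts T t -> regular t ->
    measurable A -> A `<=` rpts T ->
    haarI m (rmap (iota None) t) [set (rmap (iota None) a : 'M[F]_2) | a in A]
    = haarI m t A)
  (fE : datum F -> 'M[F]_2 -> complex R)
  (hfE : forall d, D d -> embeds T (endo_group d) ->
    is_transfer m eps abs c tau T f d (rmap (iota d)) (fE d))
  (Gam : set 'M[F]_2 -> 'M[F]_2 -> complex R)
  (hGam : shalika_germs nuGL [set rmap (iota None) t | t in rpts T]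
    (rmap (iota None) z) Gam)
  (rep : set 'M[F]_2 -> 'M[F]_2)
  (hrep : forall d cl, D d -> SU d cl -> cl (rep cl)) :
  \forall t \near z, rpts T t -> regular t ->
    orbint m t f =
      \sum_(d \in D) Phi m eps abs c tau T d (rmap (iota d)) (fE d) t
    /\
    (forall d, D d -> embeds T (endo_group d) ->
      SO m d (rmap (iota d) t) (fE d) =
        \sum_(cl \in SU d) SGamma d Gam cl (rmap (iota d) t)
          * SO m d (rmap (iota d) z *m rep cl) (fE d)).
Proof.
have Finf := local_field_infinite hF; have Tz := center_torus hT hz.
have [DN Dsep Duniq _] := hD.
have eN := SL2_id_embedding hT; have embN := hiota _ DN eN.
have germN := stable_germ hF hT hnuGL embN hz (hfE _ DN eN).1 (hrep _ _ DN (or_intror erefl)) hGam.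
have part2 : \forall t \near z, rpts T t -> regular t ->
    forall d, D d -> embeds T (endo_group d) ->
      SO m d (rmap (iota d) t) (fE d) =
        \sum_(cl \in SU d) SGamma d Gam cl (rmap (iota d) t)
          * SO m d (rmap (iota d) z *m rep cl) (fE d).
  (* At most one torus on the list receives [T], so a single neighbourhood serves all the torus
     data, even if there are infinitely many. *)
  have germT : \forall t \near z, rpts T t -> forall p, D (Some p) ->
      embeds T (norm_one_torus p) ->
      fE (Some p) (rmap (iota (Some p)) t) = fE (Some p) (rmap (iota (Some p)) z).
    have [[p [Dp ep]]|noD] := pselect (exists p, D (Some p) /\ embeds T (norm_one_torus p)).
      apply: filterS (torus_germ hF (hiota _ Dp ep) Tz (hfE _ Dp ep).1) => t ht Tt p' Dp' ep'.
      have -> : p' = p by apply: Duniq => //; exact: (embeds_unique Finf hT ep' ep htau rtau).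
      exact: ht.
    by apply: filterE => t _ p Dp ep; case: noD; exists p.
  apply: filterS2 germN germT => t hN hTo Tt rt [p|] Dd ed.
    have rep1 := hrep (Some p) _ Dd erefl.
    by rewrite /= fsbig_set1 rep1 mulmx1 mul1r hTo.
  have rep1 := hrep None _ DN (or_introl erefl).
  (* The two unipotent classes are distinct, so the germ expansion has exactly two terms. *)
  have u01 : [set 1%:M] <> GL_orbit (u0 F).
    move=> e; have : GL_orbit (u0 F) 1%:M by rewrite -e.
    move=> [g gu h1]; have /matrixP /(_ 0 1) : u0 F = 1%:M.
      by apply: (can_inj (mconjK gu)); rewrite h1 mconj_fix // mulmx1 mul1mx.
    by rewrite !mxE /= => /eqP; rewrite oner_eq0.
  rewrite /SU /SGamma /SO (fsbig_pair _ u01) rep1 mulmx1.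
  exact: (hN Tt rt).
apply: filterS part2 => t ht Tt rt; split; last exact: ht.
exact: (orbint_endoscopic_sum hF hT hD heps hc htau rtau hiota hfE Tt rt).
Qed.
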